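(* Let $\mathbf{A}\in\mathbb{H}^{m\times n}$ and $\mathbf{B}\in\mathbb{H}^{m\times s}$, and let $\mathbf{X}_{LS}=(x_{ij})\in\mathbb{H}^{n\times s}$ be the minimum norm least squares solution of the matrix equation $\mathbf{A}\mathbf{X}=\mathbf{B}$ (unknown $\mathbf{X}\in\mathbb{H}^{n\times s}$). Put $\hat{\mathbf{B}}:=\mathbf{A}^{*}\mathbf{B}\in\mathbb{H}^{n\times s}$ and let $\hat{\mathbf{b}}_{.j}$ denote the $j$th column of $\hat{\mathbf{B}}$. (i) If $\operatorname{rank}\mathbf{A}=r\le m<n$ (with $r\ge 1$), then for all $i=1,\dots,n$ and $j=1,\dots,s$, $$x_{ij}=\frac{\sum_{\beta\in J_{r,n}\{i\}}\operatorname{cdet}_i\left(\left((\mathbf{A}^{*}\mathbf{A})_{.i}(\hat{\mathbf{b}}_{.j})\right)_{\beta}^{\beta}\right)}{\sum_{\beta\in J_{r,n}}\left|(\mathbf{A}^{*}\mathbf{A})_{\beta}^{\beta}\right|}.$$ (ii) If $\operatorname{rank}\mathbf{A}=n$, then for all $i=1,\dots,n$ and $j=1,\dots,s$, $$x_{ij}=\frac{\operatorname{cdet}_i\left((\mathbf{A}^{*}\mathbf{A})_{.i}(\hat{\mathbf{b}}_{.j})\right)}{\det(\mathbf{A}^{*}\mathbf{A})}.$$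
   Context: $\mathbb{H}$ is the skew field of real (Hamilton) quaternions, $\mathbb{H}^{m\times n}$ the set of $m\times n$ quaternion matrices, $\mathbf{A}^{*}$ the conjugate transpose of $\mathbf{A}$, $\|\cdot\|$ the Frobenius norm. The rank is the usual rank of a quaternion matrix (dimension of the right column space). Minimum norm least squares solution: let $H_R=\{\mathbf{X}\in\mathbb{H}^{n\times s}: \|\mathbf{A}\mathbf{X}-\mathbf{B}\|=\min\}$ be the set of minimizers of $\|\mathbf{A}\mathbf{X}-\mathbf{B}\|$ over $\mathbb{H}^{n\times s}$ (the least squares solutions). $\mathbf{X}_{LS}$ is the element of $H_R$ of smallest Frobenius norm. Column and row determinants. Let $\mathbf{M}=(m_{ij})\in\mathbb{H}^{n\times n}$ and let $S_n$ be the symmetric group on $\{1,\dots,n\}$. All permutations are written as products of disjoint cycles, with fixed points included as cycles of length one, and $r$ denotes the number of cycles. The $i$th row determinant is $$\operatorname{rdet}_i\mathbf{M}=\sum_{\sigma\in S_n}(-1)^{n-r}m_{i\,i_{k_1}}m_{i_{k_1}i_{k_1+1}}\cdots m_{i_{k_1+l_1}\,i}\cdots m_{i_{k_r}i_{k_r+1}}\cdots m_{i_{k_r+l_r}i_{k_r}},$$ where $\sigma=(i\,i_{k_1}i_{k_1+1}\dots i_{k_1+l_1})(i_{k_2}i_{k_2+1}\dots i_{k_2+l_2})\cdots(i_{k_r}i_{k_r+1}\dots i_{k_r+l_r})$ is written so that $i$ opens the first cycle from the left, $i_{k_2}<i_{k_3}<\dots<i_{k_r}$, and $i_{k_t}<i_{k_t+u}$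 for all $t=2,\dots,r$, $u=1,\dots,l_t$. (If $i$ is a fixed point of $\sigma$, the first cycle contributes $m_{ii}$.) The $j$th column determinant is $$\operatorname{cdet}_j\mathbf{M}=\sum_{\tau\in S_n}(-1)^{n-r}m_{j_{k_r}j_{k_r+l_r}}\cdots m_{j_{k_r+1}j_{k_r}}\cdots m_{j\,j_{k_1+l_1}}\cdots m_{j_{k_1+1}j_{k_1}}m_{j_{k_1}j},$$ where $\tau=(j_{k_r+l_r}\dots j_{k_r+1}j_{k_r})\cdots(j_{k_2+l_2}\dots j_{k_2+1}j_{k_2})(j_{k_1+l_1}\dots j_{k_1+1}j_{k_1}j)$ is written so that $j$ opens the first cycle from the right, $j_{k_2}<j_{k_3}<\dots<j_{k_r}$, and $j_{k_t}<j_{k_t+u}$ for all $t=2,\dots,r$, $u=1,\dots,l_t$. (If $j$ is a fixed point of $\tau$, the first cycle contributes $m_{jj}$.) For Hermitian $\mathbf{M}$ all the $\operatorname{rdet}_i\mathbf{M}$ and $\operatorname{cdet}_i\mathbf{M}$ coincide and are real (known fact); the common value is denoted $\det\mathbf{M}$. Notation. $\mathbf{M}_{.i}(\mathbf{c})$ is the matrix obtained from $\mathbf{M}$ by replacing its $i$th column by the column $\mathbf{c}$. For $\beta\subseteq\{1,\dots,n\}$, $\mathbf{M}_\beta^\beta$ is the principal submatrix with rows and columns indexed by $\beta$; for Hermitian $\mathbf{M}$, $|\mathbf{M}_\beta^\beta|:=\det(\mathbf{M}_\beta^\beta)$. $J_{r,n}$ is the set of all strictly increasing sequences of $r$ integers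 from $\{1,\dots,n\}$ (identified with $r$-element subsets), and $J_{r,n}\{i\}=\{\beta\in J_{r,n}: i\in\beta\}$. In $\operatorname{cdet}_i(\cdot)_\beta^\beta$ with $i\in\beta$, the rows and columns of the submatrix keep their original labels from $\beta$, so that $\operatorname{cdet}_i$ is the column determinant along the column coming from the $i$th column of the full matrix. *)

(* Defs.v *)
From HB Require Import structures.
From mathcomp Require Import all_boot all_order all_algebra.
From mathcomp Require Import perm ring lra reals.
Set Implicit Arguments.
Unset Strict Implicit.
Unset Printing Implicit Defensive.
Import Order.TTheory GRing.Theory Num.Theory.
Local Open Scope ring_scope.

(** * The skew field of Hamilton quaternions [a + b i + c j + d k] *)

Record quat (R : Type) := Quat { qre : R; qimi : R; qimj : R; qimk : R }.

Section QuatEncoding.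
Variable R : Type.
Definition tuple_of_quat (x : quat R) := (qre x, qimi x, qimj x, qimk x).
Definition quat_of_tuple (t : R * R * R * R) :=
  let: (a, b, c, d) := t in Quat a b c d.
Lemma tuple_of_quatK : cancel tuple_of_quat quat_of_tuple.
Proof. by case. Qed.
End QuatEncoding.

HB.instance Definition _ (R : eqType) :=
  Equality.copy (quat R) (can_type (@tuple_of_quatK R)).
HB.instance Definition _ (R : choiceType) :=
  Choice.copy (quat R) (can_type (@tuple_of_quatK R)).

Section QuatRing.
Variable R : realFieldType.
Implicit Types x y z : quat R.

Definition zero_quat : quat R := Quat 0 0 0 0.
Definition one_quat : quat R := Quat 1 0 0 0.
Definition opp_quat x : quat R := Quat (- qre x) (- qimi x) (- qimj x) (- qimk x).
Definition add_quat x y : quat R :=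
  Quat (qre x + qre y) (qimi x + qimi y) (qimj x + qimj y) (qimk x + qimk y).
Definition mul_quat x y : quat R :=
  let: Quat a1 b1 c1 d1 := x in
  let: Quat a2 b2 c2 d2 := y in
  Quat (a1 * a2 - b1 * b2 - c1 * c2 - d1 * d2)
       (a1 * b2 + b1 * a2 + c1 * d2 - d1 * c2)
       (a1 * c2 - b1 * d2 + c1 * a2 + d1 * b2)
       (a1 * d2 + b1 * c2 - c1 * b2 + d1 * a2).

Definition conj_quat x : quat R := Quat (qre x) (- qimi x) (- qimj x) (- qimk x).
Definition sqnorm_quat x : R := qre x ^+ 2 + qimi x ^+ 2 + qimj x ^+ 2 + qimk x ^+ 2.
Definition inv_quat x : quat R :=
  Quat (qre x / sqnorm_quat x) (- qimi x / sqnorm_quat x)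
       (- qimj x / sqnorm_quat x) (- qimk x / sqnorm_quat x).

Lemma add_quatA : associative add_quat.
Proof. by move=> [????] [????] [????]; rewrite /add_quat /= !addrA. Qed.
Lemma add_quatC : commutative add_quat.
Proof. by move=> [????] [????]; congr Quat; rewrite /= addrC. Qed.
Lemma add0_quat : left_id zero_quat add_quat.
Proof. by move=> [????]; rewrite /add_quat /= !add0r. Qed.
Lemma addN_quat : left_inverse zero_quat opp_quat add_quat.
Proof. by move=> [????]; rewrite /add_quat /= !addNr. Qed.

HB.instance Definition _ := GRing.isZmodule.Build (quat R) add_quatA add_quatC add0_quat addN_quat.

Lemma mul_quatA : associative mul_quat.
Proof. by move=> [????] [????] [????]; congr Quat; ring. Qed.
Lemma mul1_quat : left_id one_quat mul_quat.
Proof. by move=> [????]; congr Quat; ring. Qed.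
Lemma mul_quat1 : right_id one_quat mul_quat.
Proof. by move=> [????]; congr Quat; ring. Qed.
Lemma mul_quatDl : left_distributive mul_quat +%R.
Proof. by move=> [????] [????] [????]; congr Quat => /=; ring. Qed.
Lemma mul_quatDr : right_distributive mul_quat +%R.
Proof. by move=> [????] [????] [????]; congr Quat => /=; ring. Qed.
Lemma one_quat_neq0 : one_quat != 0.
Proof. by apply/eqP => /(congr1 (@qre R)) /eqP; rewrite oner_eq0. Qed.

HB.instance Definition _ := GRing.Zmodule_isNzRing.Build (quat R)
  mul_quatA mul1_quat mul_quat1 mul_quatDl mul_quatDr one_quat_neq0.

Lemma sqnorm_quat_eq0 x : (sqnorm_quat x == 0) = (x == 0).
Proof.
apply/eqP/eqP => [|->]; last by rewrite /sqnorm_quat /= expr0n !addr0.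
case: x => a b c d; rewrite /sqnorm_quat /= => h.
have := (sqr_ge0 a, sqr_ge0 b, sqr_ge0 c, sqr_ge0 d) => -[[[ha hb] hc] hd].
transitivity zero_quat => //.
by congr Quat; apply/eqP; rewrite -sqrf_eq0; apply/eqP; lra.
Qed.

Lemma mulV_quat : {in [pred x : quat R | x != 0], left_inverse 1 inv_quat *%R}.
Proof.
move=> x; rewrite inE -sqnorm_quat_eq0; case: x => a b c d; rewrite /sqnorm_quat /= => h.
by transitivity one_quat => //; congr Quat; rewrite /sqnorm_quat /=; field.
Qed.
Lemma mul_quatV : {in [pred x : quat R | x != 0], right_inverse 1 inv_quat *%R}.
Proof.
move=> x; rewrite inE -sqnorm_quat_eq0; case: x => a b c d; rewrite /sqnorm_quat /= => h.
by transitivity one_quat => //; congr Quat; rewrite /sqnorm_quat /=; field.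
Qed.
Lemma unit_quatP x y : y * x = 1 /\ x * y = 1 -> x != 0.
Proof.
by case=> h _; apply/eqP => x0; move/eqP: h; rewrite x0 mulr0 eq_sym oner_eq0.
Qed.
Lemma inv_quat_out : {in [predC [pred x : quat R | x != 0]], inv_quat =1 id}.
Proof.
move=> x; rewrite !inE negbK => /eqP ->.
by rewrite /inv_quat /= oppr0 !mul0r.
Qed.

HB.instance Definition _ := GRing.NzRing_hasMulInverse.Build (quat R)
  mulV_quat mul_quatV unit_quatP inv_quat_out.

End QuatRing.

(** * Quaternion matrices *)

Section QuatMatrix.
Variable R : realType.
Local Notation H := (quat R).

Definition ctrmx m n (A : 'M[H]_(m, n)) : 'M[H]_(n, m) :=
  \matrix_(i, j) conj_quat (A j i).

Definition frobenius m n (A : 'M[H]_(m, n)) : R :=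
  Num.sqrt (\sum_i \sum_j sqnorm_quat (A i j)).

(* [A *m c] is the combination of the columns of [A] with the entries of [c]
   as coefficients on the right. *)
Definition in_rcolspace m n (A : 'M[H]_(m, n)) (v : 'cV[H]_m) : Prop :=
  exists c : 'cV[H]_n, v = A *m c.

Definition rcol_free m r (P : 'M[H]_(m, r)) : Prop :=
  forall c : 'cV[H]_r, P *m c = 0 -> c = 0.

(* The right column space of [A] has dimension [r]: it has a basis made of the
   [r] columns of some matrix [P].  (MathComp's [\rank] is restricted to
   commutative fields.) *)
Definition has_rank m n (A : 'M[H]_(m, n)) (r : nat) : Prop :=
  exists P : 'M[H]_(m, r),
    rcol_free P /\ (forall v, in_rcolspace A v <-> in_rcolspace P v).

Definition least_squares m n s (A : 'M[H]_(m, n)) (B : 'M[H]_(m, s))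
    (X : 'M[H]_(n, s)) : Prop :=
  forall Y : 'M[H]_(n, s), frobenius (A *m X - B) <= frobenius (A *m Y - B).

Definition min_norm_least_squares m n s (A : 'M[H]_(m, n)) (B : 'M[H]_(m, s))
    (X : 'M[H]_(n, s)) : Prop :=
  least_squares A B X /\
  forall Y, least_squares A B Y -> frobenius X <= frobenius Y.

(** * Row and column determinants *)

Section Determinants.
Variable n : nat.
Implicit Types (M : 'M[H]_n) (s : 'S_n) (i : 'I_n).

(* The product [m_{i,s(i)} m_{s(i),s(s(i))} ... m_{s^-1(i),i}] along the cycle
   of [s] opened by [i]; it is [m_{i,i}] if [i] is a fixed point. *)
Definition cycle_prod M s i : H :=
  \prod_(x <- traject s i #|porbit s i|) M x (s x).

(* The least elements of the cycles of [s] that do not contain [i], listed in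
   increasing order (as [enum 'I_n] is). *)
Definition cycle_mins s i : seq 'I_n :=
  [seq x <- enum 'I_n | (x \notin porbit s i) &&
                        [forall y in porbit s x, (x <= y)%N]].

(* [porbits s] is the set of all cycles of [s], including the trivial ones. *)
Definition cycle_sign s : H := (-1) ^+ (n - #|porbits s|).

Definition rdet M i : H :=
  \sum_(s : 'S_n)
    cycle_sign s * (cycle_prod M s i * \prod_(x <- cycle_mins s i) cycle_prod M s x).

(* The factors of a cycle come in the same order as in [rdet]: the cycle
   [(j_l ... j_1 j)] contributes [m_{j,j_l} ... m_{j_2,j_1} m_{j_1,j}].  Only
   the order of the cycles is reversed. *)
Definition cdet M j : H :=
  \sum_(s : 'S_n)
    cycle_sign s *
    ((\prod_(x <- rev (cycle_mins s j)) cycle_prod M s x) * cycle_prod M s j).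

Definition replace_col M i (c : 'cV[H]_n) : 'M[H]_n :=
  \matrix_(k, l) if l == i then c k 0 else M k l.

End Determinants.

(* The determinant of a Hermitian matrix, on which all the [rdet M i] and
   [cdet M i] coincide; the empty matrix has determinant 1. *)
Definition hdet n : 'M[H]_n -> H :=
  if n is n'.+1 then fun M => rdet M ord0 else fun=> 1.

(* The strictly increasing sequences of [r] indices in ['I_n]. *)
Definition Jset r n : {set r.-tuple 'I_n} :=
  [set b : r.-tuple 'I_n | sorted ltn (map val b)].

Definition principal_submx n r (M : 'M[H]_n) (b : r.-tuple 'I_n) : 'M[H]_r :=
  \matrix_(k, l) M (tnth b k) (tnth b l).

(* The column determinant of a principal submatrix along the column whose label
   in the full matrix is [i]; it is only meant for [i \in b]. *)
Definition cdet_sub n r (M : 'M[H]_n) (b : r.-tuple 'I_n) (i : 'I_n) : H :=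
  if [pick k | tnth b k == i] is Some k then cdet (principal_submx M b) k else 0.

End QuatMatrix.

(* Main.v *)
(** Write [M := A^* A], and let [ham M C i l] be the signed sum of the products of
    [M] along the Hamiltonian paths from [i] to [l] in a vertex set [C].  The
    cycle sums [\sum_l ham M C i l * M l i] are real (reverse the paths) and do
    not depend on [i] (split at a second vertex and use [Re (x y) = Re (y x)]).
    Hence the minors [pdet M B], expanded along the cycle through an element of
    [B], do not depend on this element, and with the cofactors [cofac M B i l]
    they satisfy the usual orthogonality relations.

    Summing over [#|B| = k] gives the coefficients [P_k] and [d_k] of the adjugate
    and of the determinant of [t + M], with [P_k M + P_(k+1) = d_k].  If [k] is
    maximal with [d_k != 0], a descending induction using [Y M M = 0 -> Y M = 0]
    yields [P_(k+1) M = 0], so that [d_k^-1 P_k M] is the orthogonal projection on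
    the right column space of [A^*].  Its trace has real part [k], which is therefore the
    rank of [A]; as the minimum norm solution [X] is fixed by this projection,
    [d_k X = P_k M X = P_k A^* B]. *)
Require Import Defs.
From mathcomp Require Import all_boot all_order all_algebra.
From mathcomp Require Import perm ring lra reals.
Set Implicit Arguments.
Unset Strict Implicit.
Unset Printing Implicit Defensive.
Import Order.TTheory GRing.Theory Num.Theory.
Local Open Scope ring_scope.

(** * Conjugation, real quaternions and real parts *)

Section QuatConj.
Variable R : realFieldType.
Implicit Types x y : quat R.

Lemma conj_quatK : involutive (@conj_quat R).
Proof. by case=> a b c d; rewrite /conj_quat /= !opprK. Qed.

Lemma conj_quat0 : conj_quat (0 : quat R) = 0.
Proof. by congr Quat; rewrite /= oppr0. Qed.

Lemma conj_quat1 : conj_quat (1 : quat R) = 1.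
Proof. by congr Quat; rewrite /= oppr0. Qed.

Lemma conj_quatN x : conj_quat (- x) = - conj_quat x.
Proof. by []. Qed.

Lemma conj_quatD x y : conj_quat (x + y) = conj_quat x + conj_quat y.
Proof. by congr Quat; rewrite /= ?opprD. Qed.

Lemma conj_quatM x y : conj_quat (x * y) = conj_quat y * conj_quat x.
Proof. by case: x y => [????] [????]; congr Quat; rewrite /=; ring. Qed.

Lemma conj_quat_nat n : conj_quat (n%:R : quat R) = n%:R.
Proof.
by elim: n => [|n IH]; rewrite ?conj_quat0 // mulrS conj_quatD IH conj_quat1.
Qed.

Lemma conj_quat_sum I (r : seq I) (P : pred I) (F : I -> quat R) :
  conj_quat (\sum_(i <- r | P i) F i) = \sum_(i <- r | P i) conj_quat (F i).
Proof. exact: (big_morph _ conj_quatD conj_quat0). Qed.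

Lemma conj_quat_prod I (r : seq I) (F : I -> quat R) :
  conj_quat (\prod_(i <- r) F i) = \prod_(i <- rev r) conj_quat (F i).
Proof.
elim: r => [|x r IH]; first by rewrite !big_nil conj_quat1.
by rewrite big_cons conj_quatM IH rev_cons -cats1 big_cat big_seq1.
Qed.

Lemma conj_quat_fix x : conj_quat x = x -> x = Quat (qre x) 0 0 0.
Proof. by case: x => a b c d [] /= *; congr Quat; lra. Qed.

Lemma conj_quat_fix_comm x y : conj_quat x = x -> x * y = y * x.
Proof.
by move/conj_quat_fix ->; case: y => a b c d; congr Quat; rewrite /=; ring.
Qed.

Lemma qreM_comm x y : qre (x * y) = qre (y * x).
Proof. by case: x y => [????] [????] /=; ring. Qed.

Lemma qre_sum I (r : seq I) (P : pred I) (F : I -> quat R) :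
  qre (\sum_(i <- r | P i) F i) = \sum_(i <- r | P i) qre (F i).
Proof. exact: (big_morph (@qre R)). Qed.

Lemma qreMn x n : qre (x *+ n) = qre x *+ n.
Proof. by elim: n => // n IH; rewrite !mulrS /= IH. Qed.

(** Reduces an identity between real quaternions to real parts, where [qreM_comm] allows factors to
    be swapped. *)
Lemma conj_quat_fix_inj x y :
  conj_quat x = x -> conj_quat y = y -> qre x = qre y -> x = y.
Proof. by move=> /conj_quat_fix -> /conj_quat_fix -> /= ->. Qed.

End QuatConj.

Lemma ltn_cardsD1 (T : finType) (C : {set T}) x n :
  x \in C -> (#|C| < n.+1)%N -> (#|C :\ x| < n)%N.
Proof. by rewrite ltnS [#|C|](cardsD1 x) => ->. Qed.

(** * Signed sums over Hamiltonian paths and cycles *)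

Section PathSums.
Variables (R : realFieldType) (T : finType) (M : T -> T -> quat R).
Implicit Types (C D : {set T}) (i j l t : T).

(** The counter is the number of edges. A path is unfolded from its last vertex [l], and each edge
    contributes a factor [-1]. *)
Fixpoint path_sum n C i l : quat R :=
  if n is n'.+1 then
    if (l \in C) && (l != i) then - \sum_t path_sum n' (C :\ l) i t * M t l
    else 0
  else ((C == [set i]) && (l == i))%:R.

(* The sum of [(-1)^(#|C|-1) M i x1 * M x1 x2 * ... * M xk l] over all
   Hamiltonian paths [i, x1, ..., xk, l] of [C]. *)
Definition ham C i l := path_sum #|C|.-1 C i l.

(** For [j = i] in [C] the extra edge closes the path: [step C i i] runs over the cyclic
    permutations of [C], weighted with their signatures. *)
Definition step C i j := \sum_t ham C i t * M t j.

Lemma ham_out C i l : ~~ ((i \in C) && (l \in C)) -> ham C i l = 0.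
Proof.
rewrite /ham; move: _.-1 => n; elim: n C i l => [|n IH] C i l /=.
  by case: eqP => [->|//]; case: eqP => [->|//]; rewrite !inE eqxx.
case: ifP => // /andP[lC li]; rewrite lC andbT => iC.
by rewrite big1 ?oppr0 // => t _; rewrite IH ?mul0r // !inE (negPf iC) andbF.
Qed.

Lemma ham_outl C i l : i \notin C -> ham C i l = 0.
Proof. by move=> iC; rewrite ham_out // (negPf iC). Qed.

Lemma ham_outr C i l : l \notin C -> ham C i l = 0.
Proof. by move=> iC; rewrite ham_out // (negPf iC) andbF. Qed.

Lemma step_out C i j : i \notin C -> step C i j = 0.
Proof. by move=> iC; rewrite /step big1 // => t _; rewrite ham_outl ?mul0r. Qed.

Lemma ham_diag C i : ham C i i = (C == [set i])%:R.
Proof.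
rewrite /ham; case E: #|C|.-1 => [|n] /=; first by rewrite eqxx andbT.
rewrite eqxx andbF; case: eqP E => // ->; by rewrite cards1.
Qed.

Lemma ham_rec C i l : l \in C -> l != i -> ham C i l = - step (C :\ l) i l.
Proof.
move=> lC li; rewrite /step {1}/ham (cardsD1 l) lC add1n /=.
case E: #|C :\ l| => [|n] /=; last by rewrite lC li /ham E.
move/eqP: E; rewrite cards_eq0 => /eqP ->; rewrite (negPf li) andbF.
by rewrite big1 ?oppr0 // => t _; rewrite ham_outl ?mul0r ?inE.
Qed.

(** Mirror image of [ham_rec], to be compared with it when conjugation reverses paths. By induction
    on [#|C|], the two ends can be peeled off in either order. *)
Lemma ham_recl C i l : i \in C -> l != i ->
  ham C i l = - \sum_t M i t * ham (C :\ i) t l.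
Proof.
have [n] := ubnP #|C|; elim: n C i l => // n IH C i l ltn iC li.
have [lC|lC] := boolP (l \in C); last first.
  rewrite ham_outr // big1 ?oppr0 // => t _.
  by rewrite ham_outr ?mulr0 // !inE (negPf lC) andbF.
have il : i != l by rewrite eq_sym.
have lCi : l \in C :\ i by rewrite !inE li.
have iCl : i \in C :\ l by rewrite !inE il.
rewrite ham_rec // /step; congr (- _).
(* The terms [t = i] and [t = l] singled out here account for the path with a single edge. *)
rewrite (bigD1 i) //= [RHS](bigD1 l) //= !ham_diag.
congr (_ + _).
  have -> : (C :\ l == [set i]) = (C :\ i == [set l]).
    apply/eqP/eqP => /setP h; apply/setP => x; have:= h x; rewrite !inE;
    (have [->|_] := eqVneq x l); rewrite ?(negPf li) ?lC ?eqxx //=;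
    by (have [->|_] := eqVneq x i); rewrite ?(negPf il) ?iC ?eqxx.
  by case: eqP; rewrite ?mul1r ?mulr1 ?mul0r ?mulr0.
under eq_bigr => t ti do rewrite IH ?(ltn_cardsD1 lC ltn) // mulNr big_distrl /=.
under [RHS]eq_bigr => t tl do rewrite ham_rec // 1?eq_sym // mulrN big_distrr /=.
rewrite !sumrN; congr (- _).
rewrite big_mkcond [RHS]big_mkcond /=.
transitivity (\sum_t \sum_u M i u * ham (C :\ l :\ i) u t * M t l).
  apply: eq_bigr => t _; case: eqVneq => [->|//] /=.
  by rewrite big1 // => u _; rewrite ham_outr ?mulr0 ?mul0r // !inE eqxx.
rewrite exchange_big; apply: eq_bigr => u _ /=.
have -> : C :\ i :\ l = C :\ l :\ i by apply/setP => x; rewrite !inE andbCA.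
case: eqVneq => [->|ul] /=; last by apply: eq_bigr => t _; rewrite mulrA.
by rewrite big1 // => t _; rewrite ham_outl ?mulr0 ?mul0r // !inE eqxx andbF.
Qed.

(** A Hamiltonian path meets [j] exactly once, and [D] collects the vertices before it. The sign
    exponents [#|D| - 1] and [#|C| - #|D| - 1] add up to [#|C| - 2], hence the minus sign. *)
Lemma ham_cat C i j l : j \in C -> j != i ->
  ham C i l = - \sum_(D : {set T} | D \subset C) step D i j * ham (C :\: D) j l.
Proof.
have [n] := ubnP #|C|; elim: n C l => // n IH C l ltn jC ji.
have [lC|lC] := boolP (l \in C); last first.
  rewrite ham_outr // big1 ?oppr0 // => D _.
  by rewrite ham_outr ?mulr0 // !inE (negPf lC) andbF.
have [->|lj] := eqVneq l j.
  (* When the path ends at [j], everything else comes before [j]: only [D = C :\ j] contributes. *)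
  rewrite ham_rec // (bigD1 (C :\ j)) ?subD1set //=.
  rewrite big1 => [|D /andP[DC Dn]]; last first.
    rewrite ham_diag; case: eqP => [E|]; last by rewrite mulr0.
    by case/eqP: Dn; rewrite -E setDDr setDv set0U; apply/esym/setIidPr.
  suff -> : C :\: (C :\ j) = [set j] by rewrite ham_diag eqxx mulr1 addr0.
  by apply/setP => x; rewrite !inE; case: eqVneq => [->|_]; rewrite ?jC //= andNb.
have [->|li] := eqVneq l i.
  rewrite ham_diag; case: eqP => [E|_].
    by move: jC ji; rewrite E !inE => /eqP->; rewrite eqxx.
  rewrite big1 ?oppr0 // => D _; have [iD|iD] := boolP (i \in D).
    by rewrite ham_outr ?mulr0 // !inE iD.
  by rewrite step_out ?mul0r.
rewrite ham_rec // /step; congr (- _).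
have jCl : j \in C :\ l by rewrite !inE eq_sym lj.
under eq_bigr => t _ do rewrite IH ?(ltn_cardsD1 lC ltn) // mulNr big_distrl /=.
rewrite sumrN exchange_big /= -sumrN.
rewrite [RHS](bigID (fun D : {set T} => l \in D)) /= [X in _ = X + _]big1 ?add0r.
  apply: eq_big => [D|D]; first by rewrite subsetD1.
  rewrite subsetD1 => /andP[DC lD].
  rewrite ham_rec ?inE ?lC ?lD // /step mulrN; congr (- _).
  rewrite big_distrr /=; apply: eq_bigr => t _; rewrite mulrA.
  by congr (_ * ham _ _ _ * _); apply/setP => x; rewrite !inE andbCA.
by move=> D /andP[_ lD]; rewrite ham_outr ?mulr0 // !inE lD.
Qed.

Lemma step_cat C i j l : j \in C -> j != i ->
  step C i l = - \sum_(D : {set T} | D \subset C) step D i j * step (C :\: D) j l.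
Proof.
move=> jC ji; rewrite /step.
under eq_bigr => t _ do rewrite (ham_cat _ jC ji) mulNr big_distrl /=.
rewrite sumrN exchange_big; congr (- _); apply: eq_bigr => D _ /=.
by rewrite [RHS]big_distrr; apply: eq_bigr => t _ /=; rewrite mulrA.
Qed.

Hypothesis M_herm : forall x y, conj_quat (M x y) = M y x.

Lemma conj_ham C i l : conj_quat (ham C i l) = ham C l i.
Proof.
have [n] := ubnP #|C|; elim: n C i l => // n IH C i l ltn.
have [lC|lC] := boolP (l \in C); last first.
  by rewrite ham_outr // ham_outl // conj_quat0.
have [->|li] := eqVneq l i; first by rewrite ham_diag conj_quat_nat.
rewrite ham_rec // ham_recl // 1?eq_sym // conj_quatN conj_quat_sum; congr (- _).
apply: eq_bigr => t _; by rewrite conj_quatM M_herm IH ?(ltn_cardsD1 lC ltn).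
Qed.

(** Conjugation reverses the cycles. Once the one-point cycle is split off, removing [i] turns both
    orientations into the same double sum over the two neighbours of [i]. *)
Lemma conj_cyc C i : conj_quat (step C i i) = step C i i.
Proof.
have [iC|iC] := boolP (i \in C); last by rewrite step_out ?conj_quat0.
rewrite /step conj_quat_sum.
under eq_bigr => l _ do rewrite conj_quatM M_herm conj_ham.
rewrite (bigD1 i) //= [RHS](bigD1 i) //=; congr (_ + _).
  by rewrite ham_diag; case: eqP; rewrite ?mul1r ?mulr1 ?mul0r ?mulr0.
transitivity (- \sum_l \sum_t M i l * ham (C :\ i) l t * M t i).
  rewrite [X in _ = - X](bigD1 i) //= [X in - (X + _)]big1 ?add0r.
    rewrite -sumrN; apply: eq_bigr => l li; rewrite ham_rec // 1?eq_sym // mulrN.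
    by rewrite /step big_distrr /=; congr (- _); apply: eq_bigr => t _; rewrite mulrA.
  by move=> t _; rewrite ham_outl ?mulr0 ?mul0r // !inE eqxx.
rewrite exchange_big [X in - X = _](bigD1 i) //= [X in - (X + _)]big1 ?add0r.
  rewrite -sumrN; apply: eq_bigr => l li; rewrite ham_recl // mulNr.
  by rewrite big_distrl.
by move=> t _; rewrite ham_outr ?mulr0 ?mul0r // !inE eqxx.
Qed.

Lemma cyc_rotate C i j : i \in C -> j \in C -> step C i i = step C j j.
Proof.
move=> iC jC; have [->//|ji] := eqVneq j i.
apply: conj_quat_fix_inj; rewrite ?conj_cyc //.
rewrite (step_cat _ jC ji) (@step_cat C j i j) // 1?eq_sym //=.
(* Both sides are sums over the two arcs between [i] and [j]; the arcs are exchanged by the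
   involution [D] to [C :\: D] on the subsets of [C]. *)
congr (- _); rewrite !qre_sum [RHS](reindex_onto (setD C) (setD C)) /=; last first.
  by move=> D DC; rewrite setDDr setDv set0U; apply/setIidPr.
apply: eq_big => [D|D DC]; last first.
  by rewrite qreM_comm setDDr setDv set0U (setIidPr _).
rewrite subsetDl setDDr setDv set0U /=.
by apply/idP/eqP => [/setIidPr //|<-]; rewrite subsetIl.
Qed.
End PathSums.

(** * Principal minors and cofactors *)

Section PrincipalMinors.
Variables (R : realFieldType) (T : finType) (M : T -> T -> quat R).
Implicit Types (B C D : {set T}) (i j l t : T).
Local Notation ham := (ham M).
Local Notation step := (step M).

(** The counter bounds the depth of the recursion; [#|B|] is enough, as each call removes a nonempty
    cycle. *)
Fixpoint pdet_rec n B : quat R :=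
  if n isn't n'.+1 then 1 else
  if [pick i in B] isn't Some i then 1 else
  \sum_(C : {set T} | (C \subset B) && (i \in C)) pdet_rec n' (B :\: C) * step C i i.

(* The principal minor on [B], expanded along the cycle through some element
   of [B]; for Hermitian [M] this element is irrelevant. *)
Definition pdet B := pdet_rec #|B| B.

(** The adjugate of the submatrix on [B]: [C] carries the cycle through [i], cut open into a path
    from [i] to [l], and the minor collects the other cycles. *)
Definition cofac B i l :=
  \sum_(C : {set T} | C \subset B) pdet (B :\: C) * ham C i l.

Lemma ltn_cardsD C B i n :
  i \in C -> C \subset B -> (#|B| < n.+1)%N -> (#|B :\: C| < n)%N.
Proof.
move=> iC CB ltn; apply: leq_ltn_trans (ltn_cardsD1 (subsetP CB _ iC) ltn).
by apply/subset_leq_card/setDS; rewrite sub1set.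
Qed.

Lemma pdet_recE n B : (#|B| <= n)%N -> pdet_rec n B = pdet B.
Proof.
suff H m : (#|B| <= n)%N -> (#|B| <= m)%N -> pdet_rec n B = pdet_rec m B.
  by move=> ?; apply: H.
elim: n m B => [|n IH] [|m] B //=.
- rewrite leqn0 cards_eq0 => /eqP -> _.
  by case: pickP => // x; rewrite inE.
- rewrite leqn0 cards_eq0 => _ /eqP ->.
  by case: pickP => // x; rewrite inE.
move=> ln lm; case: pickP => // i iB; apply: eq_bigr => C /andP[CB iC].
by congr (_ * _); apply: IH; rewrite -ltnS; apply: ltn_cardsD iC CB _.
Qed.

Lemma pdet0 : pdet set0 = 1.
Proof. by rewrite /pdet cards0. Qed.

Hypothesis M_herm : forall x y, conj_quat (M x y) = M y x.

Lemma pdet_pick B : B != set0 -> exists2 i, i \in B &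
  pdet B = \sum_(C : {set T} | (C \subset B) && (i \in C))
             pdet (B :\: C) * step C i i.
Proof.
move=> /set0Pn[x xB]; rewrite {1}/pdet (cardsD1 x) xB /=.
case: pickP => [i iB|/(_ x)]; last by rewrite xB.
exists i => //; apply: eq_bigr => C /andP[CB iC]; congr (_ * _).
apply: pdet_recE; rewrite -ltnS; apply: ltn_cardsD iC CB _.
by rewrite [#|B|](cardsD1 x) xB.
Qed.

Lemma conj_pdet B : conj_quat (pdet B) = pdet B.
Proof.
have [n] := ubnP #|B|; elim: n B => // n IH B ltn.
have [->|/pdet_pick[i iB ->]] := eqVneq B set0; first by rewrite pdet0 conj_quat1.
rewrite conj_quat_sum; apply: eq_bigr => C /andP[CB iC].
by rewrite conj_quatM conj_cyc // IH ?(conj_quat_fix_comm _ (conj_cyc M_herm _ _))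
   ?(ltn_cardsD iC CB ltn).
Qed.

(** Let [j] be the element picked by the definition. Cycles through both [i] and [j] are handled by
    [cyc_rotate]. For a cycle through only one of them, the complementary minor is expanded at the
    other by induction; both sides become sums over pairs of disjoint cycles, whose real weights
    commute. *)
Lemma pdetE B i : i \in B ->
  pdet B = \sum_(C : {set T} | (C \subset B) && (i \in C))
             pdet (B :\: C) * step C i i.
Proof.
have [n] := ubnP #|B|; elim: n B i => // n IH B i ltn iB.
have /pdet_pick[j jB ->] : B != set0 by apply/set0Pn; exists i.
have [->//|ij] := eqVneq i j.
rewrite (bigID (fun C : {set T} => i \in C)) /= [RHS](bigID (fun C : {set T} => j \in C)) /=.
congr (_ + _).
  apply: eq_big => [C|C /andP[/andP[CB jC] iC]]; first by rewrite andbAC.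
  by rewrite (cyc_rotate M_herm jC iC).
pose G k l (C D : {set T}) := pdet (B :\: C :\: D) * step D l l * step C k k.
transitivity (\sum_(C : {set T} | [&& C \subset B, j \in C & i \notin C])
   \sum_(D : {set T} | (D \subset B :\: C) && (i \in D)) G j i C D).
  apply: eq_big => [C|C /andP[/andP[CB jC] iC]]; first by rewrite andbA.
  by rewrite (IH _ i) ?(ltn_cardsD jC CB ltn) ?inE ?iC //= big_distrl.
transitivity (\sum_(C : {set T} | [&& C \subset B, i \in C & j \notin C])
   \sum_(D : {set T} | (D \subset B :\: C) && (j \in D)) G i j C D); last first.
  apply: eq_big => [C|C /and3P[CB jC iC]]; first by rewrite andbA.
  by rewrite (IH _ j) ?(ltn_cardsD jC CB ltn) ?inE ?iC //= big_distrl.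
rewrite (exchange_big_dep (fun D => [&& D \subset B, i \in D & j \notin D])) /=.
  apply: eq_bigr => D /and3P[DB iD jD].
  apply: eq_big => [C|C _].
    rewrite !subsetD DB iD [[disjoint D & C]]disjoint_sym /= andbT.
    case dCD: [disjoint C & D]; last by rewrite !andbF.
    by rewrite (disjointFl dCD iD) !andbT.
  rewrite /G !setDDl [D :|: C]setUC -!mulrA; congr (_ * _).
  by rewrite conj_quat_fix_comm ?conj_cyc.
move=> C D /and3P[CB jC iC]; rewrite subsetD => /andP[/andP[-> dDC] ->] /=.
by rewrite (disjointFl dDC jC).
Qed.

Lemma cofac_outl B i l : i \notin B -> cofac B i l = 0.
Proof.
move=> iB; rewrite /cofac big1 // => C CB; rewrite ham_outl ?mulr0 //.
exact: contra (subsetP CB i) iB.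
Qed.

Lemma cofac_outr B i l : l \notin B -> cofac B i l = 0.
Proof.
move=> iB; rewrite /cofac big1 // => C CB; rewrite ham_outr ?mulr0 //.
exact: contra (subsetP CB l) iB.
Qed.

Lemma cofac_diag B i : i \in B -> cofac B i i = pdet (B :\ i).
Proof.
move=> iB; rewrite /cofac (bigD1 [set i]) ?sub1set //= ham_diag eqxx mulr1.
by rewrite big1 ?addr0 // => C /andP[_ /negPf Ci]; rewrite ham_diag Ci mulr0.
Qed.

Lemma cofac_step B i l :
  \sum_t cofac B i t * M t l = \sum_(C : {set T} | C \subset B) pdet (B :\: C) * step C i l.
Proof.
under eq_bigr => t _ do rewrite /cofac big_distrl /=.
rewrite exchange_big; apply: eq_bigr => C _ /=.
by rewrite big_distrr /=; apply: eq_bigr => t _; rewrite mulrA.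
Qed.

Lemma cofac_rec B i l : l \in B -> l != i ->
  cofac B i l = - \sum_t cofac (B :\ l) i t * M t l.
Proof.
move=> lB li; rewrite cofac_step /cofac (bigID (fun C : {set T} => l \in C)) /=.
rewrite [X in _ + X]big1 ?addr0 => [|C /andP[_ lC]]; last by rewrite ham_outr ?mulr0.
rewrite -sumrN (reindex_onto (fun C => l |: C) (fun C => C :\ l)) /=; last first.
  by move=> C /andP[_ lC]; rewrite setD1K.
have E C : (((l |: C) \subset B) && (l \in l |: C) && ((l |: C) :\ l == C)) = (C \subset B :\ l).
  rewrite subUset sub1set lB setU11 subsetD1 /= andbT.
  case: (boolP (l \in C)) => lC; last by rewrite setU1K ?eqxx.
  rewrite andbF; apply/negbTE; rewrite negb_and; apply/orP; right.
  by apply/eqP => E; move: lC; rewrite -E !inE eqxx.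
apply: eq_big => [C|C]; first by rewrite E.
rewrite E subsetD1 => /andP[CB lC]; rewrite ham_rec ?setU11 // setU1K // mulrN.
by rewrite -setDDl.
Qed.

Lemma pdet_cofac B i : i \in B -> \sum_t cofac B i t * M t i = pdet B.
Proof.
move=> iB; rewrite cofac_step (pdetE iB) (bigID (fun C : {set T} => i \in C)) /=.
by rewrite [X in _ + X]big1 ?addr0 // => C /andP[_ iC]; rewrite step_out ?mulr0.
Qed.

(** If [C] contains [l], then [step_cat] splits off a cycle through [l]; if not, expanding the
    complementary minor at [l] yields such a cycle. The two double sums agree up to the sign in
    [step_cat] and cancel. *)
Lemma cofac_orth B i l : l \in B -> i != l -> \sum_t cofac B i t * M t l = 0.
Proof.
move=> lB il; have li : l != i by rewrite eq_sym.
rewrite cofac_step (bigID (fun C : {set T} => l \in C)) /=.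
pose G C D := pdet (B :\: (C :|: D)) * (step C i l * step D l l).
apply/eqP; rewrite addr_eq0 -sumrN; apply/eqP.
transitivity (- \sum_(C : {set T} | (C \subset B) && (l \notin C))
   \sum_(D : {set T} | (D \subset B :\: C) && (l \in D)) G C D); last first.
  rewrite -sumrN; apply: eq_bigr => C /andP[CB lC]; congr (- _).
  rewrite (@pdetE _ l) ?inE ?lC // big_distrl /=; apply: eq_bigr => D _.
  by rewrite /G setDDl -!mulrA (conj_quat_fix_comm (step C i l)) ?conj_cyc.
transitivity (- \sum_(C : {set T} | (C \subset B) && (l \in C))
  \sum_(D : {set T} | (D \subset C) && (l \notin D)) G D (C :\: D)).
  rewrite -sumrN; apply: eq_bigr => C /andP[CB lC].
  rewrite (step_cat M l lC li) mulrN; congr (- _); rewrite big_distrr /=.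
  rewrite (bigID (fun D : {set T} => l \notin D)) /= [X in _ + X]big1 ?addr0; last first.
    by move=> D /andP[_]; rewrite negbK => lD; rewrite [step (_ :\: _) _ _]step_out ?mulr0 // !inE lD.
  apply: eq_bigr => D /andP[DC lD]; rewrite /G.
  suff -> : D :|: C :\: D = C by [].
  by rewrite setUC; apply/setP => x; rewrite !inE; have := subsetP DC x;
     case: (x \in D) => [->|_] //=; rewrite ?orbF ?orbT.
congr (- _).
rewrite (exchange_big_dep (fun D => (D \subset B) && (l \notin D))) /=; last first.
  by move=> C D /andP[CB lC] /andP[DC ->]; rewrite (subset_trans DC CB).
apply: eq_bigr => D /andP[DB lD].
(* The outer set is replaced by its part outside [D], the vertex set of the cycle through [l]. *)
rewrite (reindex_onto (setU D) (fun C => C :\: D)) /=; last first.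
  move=> C /andP[_ /andP[DC _]]; rewrite setUC; apply/setP => x; rewrite !inE.
  by have := subsetP DC x; case: (x \in D) => [->|_] //=; rewrite ?orbF ?orbT.
have E C : ((D :|: C) :\: D == C) = [disjoint C & D].
  by rewrite setDUl setDv set0U; apply/eqP/setDidPl.
apply: eq_big => [C|C /andP[_ /eqP->] //].
rewrite E subUset DB subsetUl !inE (negPf lD) /= subsetD andbT.
by rewrite andbAC.
Qed.
End PrincipalMinors.

(** * Invariance under injective relabelling of the indices *)

Section Relabel.
Variables (R : realFieldType) (T U : finType) (g : U -> T).
Hypothesis g_inj : injective g.
Variable M : T -> T -> quat R.
Variable Mg : U -> U -> quat R.
Hypothesis MgE : forall u v, Mg u v = M (g u) (g v).

Lemma sum_imset (V : nmodType) (F : T -> V) (B : {set U}) :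
  (forall t, t \notin g @: B -> F t = 0) -> \sum_t F t = \sum_u F (g u).
Proof.
move=> F0; rewrite (bigID (mem (g @: B))) /= [X in _ + X]big1 // addr0.
rewrite big_imset /=; last by move=> x y _ _ /g_inj.
rewrite [RHS](bigID (mem B)) /= [X in _ = _ + X]big1 ?addr0 // => u uB.
by rewrite F0 // mem_imset.
Qed.

Lemma sum_subset_imset (V : nmodType) (F : {set T} -> V) (P : pred {set T}) (B : {set U}) :
  \sum_(C : {set T} | (C \subset g @: B) && P C) F C =
  \sum_(C : {set U} | (C \subset B) && P (g @: C)) F (g @: C).
Proof.
rewrite (reindex_onto (fun C : {set U} => g @: C) (fun C => g @^-1: C)) /=; last first.
  move=> C /andP[CB _]; apply/setP => t; apply/imsetP/idP => [[u]|tC].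
    by rewrite inE => ? ->.
  by have /imsetP[u _ tu] := subsetP CB t tC; exists u; rewrite // inE -tu.
apply: eq_bigl => C; suff -> : g @^-1: (g @: C) = C.
  rewrite eqxx andbT; congr (_ && _); apply/subsetP/subsetP => sCB u.
    by move=> uC; rewrite -(mem_imset _ _ g_inj) sCB // imset_f.
  by case/imsetP => v vC ->; rewrite imset_f // sCB.
by apply/setP => u; rewrite inE mem_imset.
Qed.

Lemma imset_D1 (B : {set U}) u : g @: (B :\ u) = g @: B :\ g u.
Proof.
apply/setP => t; rewrite !inE; apply/imsetP/andP => [[v]|[tu /imsetP[v vB tv]]].
  by rewrite !inE => /andP[vu vB] ->; rewrite inj_eq // imset_f.
by exists v => //; rewrite !inE vB andbT; apply: contra_neq tu => <-.
Qed.

Lemma imset_D (B C : {set U}) : g @: (B :\: C) = g @: B :\: g @: C.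
Proof.
apply/setP => t; rewrite !inE; apply/imsetP/andP => [[v]|[tu /imsetP[v vB tv]]].
  by rewrite !inE => /andP[vu vB] ->; rewrite mem_imset // imset_f.
exists v => //; rewrite !inE vB andbT; apply: contra tu => vC.
by rewrite tv imset_f.
Qed.

Lemma ham_relabel (C : {set U}) i l : ham Mg C i l = ham M (g @: C) (g i) (g l).
Proof.
have [n] := ubnP #|C|; elim: n C l => // n IH C l ltn.
have [lC|lC] := boolP (l \in C); last by rewrite !ham_outr ?mem_imset.
have [->|li] := eqVneq l i.
  rewrite !ham_diag -imset_set1; congr (nat_of_bool _)%:R.
  by rewrite (inj_eq (imset_inj g_inj)).
rewrite !ham_rec ?inj_eq ?imset_f // /step; congr (- _).
rewrite (sum_imset (B := C)); last first.
  by move=> t tC; rewrite ham_outr ?mul0r // !inE (negPf tC) andbF.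
by apply: eq_bigr => t _; rewrite MgE IH ?(ltn_cardsD1 lC ltn) // imset_D1.
Qed.

Lemma step_relabel (C : {set U}) i l : step Mg C i l = step M (g @: C) (g i) (g l).
Proof.
rewrite /step (sum_imset (B := C)); last by move=> t tC; rewrite ham_outr ?mul0r.
by apply: eq_bigr => t _; rewrite MgE ham_relabel.
Qed.

Hypothesis M_herm : forall x y, conj_quat (M x y) = M y x.

Lemma pdet_relabel (B : {set U}) : pdet Mg B = pdet M (g @: B).
Proof.
have Mg_herm u v : conj_quat (Mg u v) = Mg v u by rewrite !MgE.
have [n] := ubnP #|B|; elim: n B => // n IH B ltn.
have [->|/set0Pn[i iB]] := eqVneq B set0; first by rewrite imset0 !pdet0.
rewrite (@pdetE _ _ Mg _ _ i) // (@pdetE _ _ M _ _ (g i)) ?imset_f //.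
rewrite sum_subset_imset; apply: eq_big => [C|C /andP[CB iC]]; rewrite ?mem_imset //.
by rewrite IH ?(ltn_cardsD iC CB ltn) // imset_D step_relabel.
Qed.

Lemma cofac_relabel (B : {set U}) i l :
  cofac Mg B i l = cofac M (g @: B) (g i) (g l).
Proof.
rewrite /cofac; under [RHS]eq_bigl => C do rewrite -[_ \subset _]andbT.
rewrite (sum_subset_imset _ predT); apply: eq_big => [C|C _]; rewrite ?andbT //.
by rewrite pdet_relabel imset_D ham_relabel.
Qed.

End Relabel.

(** * Cycles of permutations and insertion of a point into a cycle *)

Section Porbits.
Variable T : finType.
Implicit Types (s : {perm T}) (x y i l : T).

Lemma porbit_stable s x y : (s y \in porbit s x) = (y \in porbit s x).
Proof. by rewrite -!eq_porbit_mem -(porbit_perm s 1 y) expg1. Qed.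

Lemma card_porbit_gt0 s x : (0 < #|porbit s x|)%N.
Proof. by rewrite lt0n card_porbit_neq0. Qed.

Lemma porbit_return s x m : (0 < m)%N -> uniq (traject s x m) ->
  iter m s x = x -> #|porbit s x| = m.
Proof.
move=> m_gt0 Um itm; apply/eqP; rewrite eqn_leq; apply/andP; split.
  (* Were the orbit longer than [m], its duplicate-free listing would show [x] again at position
     [m]. *)
  rewrite leqNgt; apply/negP => ltm.
  have := uniq_traject_porbit s x; rewrite -(subnKC ltm) addSn /=.
  rewrite trajectD => /andP[/negP[]]; rewrite mem_cat; apply/orP; left.
  apply/trajectP; exists m.-1; first by rewrite prednK.
  by rewrite -iterSr prednK.
rewrite -{1}(size_traject s x m) cardE; apply: uniq_leq_size => // y.
by case/trajectP => k _ ->; rewrite mem_enum -permX mem_porbit.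
Qed.

Lemma porbit_fixed s x : s x = x -> porbit s x = [set x].
Proof.
move=> sx; apply/setP => y; rewrite porbit_traject.
by rewrite (@porbit_return s x 1) //= !inE.
Qed.

Lemma traject_rcons_inv s x :
  traject s x #|porbit s x| = rcons (traject s x #|porbit s x|.-1) ((s^-1)%g x).
Proof.
rewrite -{1}(prednK (card_porbit_gt0 s x)) trajectSr; congr rcons.
by apply: (@perm_inj _ s); rewrite permKV -iterS prednK ?iter_porbit ?card_porbit_gt0.
Qed.

Lemma eq_in_iter (A : {set T}) s s' x : {in A, s =1 s'} ->
  {in A, forall y, s y \in A} -> x \in A -> forall k, (iter k s x = iter k s' x) * (iter k s x \in A).
Proof.
move=> es stA xA; elim=> [|k [E IHA]]; first by split.
by rewrite /= -E -es //; split; last exact: stA.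
Qed.

Lemma eq_in_porbit (A : {set T}) s s' x : {in A, s =1 s'} ->
  {in A, forall y, s y \in A} -> x \in A -> porbit s x = porbit s' x.
Proof.
move=> es stA xA; apply/setP => y.
by apply/porbitP/porbitP => -[k ->]; exists k; rewrite !permX (eq_in_iter es stA xA).
Qed.

Section RemovePoint.
Variables (s : {perm T}) (i l : T).
Hypotheses (sl : s l = l) (li : l != i).
Local Notation s1 := (s * tperm i l)%g.

(** Products of permutations apply the left factor first, so [s1] sends the predecessor of [i] to
    [l] and [l] to [i]: the point [l] is appended to the cycle opened by [i], and the iterates
    before it do not change. *)
Lemma iter_insert k : (k < #|porbit s i|)%N -> iter k s1 i = iter k s i.
Proof.
elim: k => // k IH ltk; rewrite /= IH ?(ltnW ltk) // permM -iterS.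
have Ei : #|porbit s i| = (#|porbit s i|.-1).+1 by rewrite prednK ?card_porbit_gt0.
rewrite tpermD //; last first.
  apply: contra_neq li => lE; have : l \in porbit s i by rewrite lE -permX mem_porbit.
  by rewrite porbit_sym porbit_fixed // inE => /eqP.
have := uniq_traject_porbit s i; rewrite Ei /= => /andP[/trajectP iN _].
apply/eqP => iE; apply: iN; exists k; last by rewrite -iterSr iterS -iE.
by rewrite -ltnS -Ei.
Qed.

Lemma traject_insert : traject s1 i #|porbit s i|.+1 = rcons (traject s i #|porbit s i|) l.
Proof.
rewrite trajectSr; congr rcons.
  apply: (@eq_from_nth _ i); rewrite !size_traject // => k ltk.
  by rewrite !nth_traject // iter_insert.
rewrite -(prednK (card_porbit_gt0 s i)) iterS iter_insert ?prednK ?card_porbit_gt0 //.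
by rewrite permM -iterS prednK ?card_porbit_gt0 // iter_porbit tpermL.
Qed.

Lemma card_porbit_insert : #|porbit s1 i| = #|porbit s i|.+1.
Proof.
apply: porbit_return => //.
  rewrite traject_insert rcons_uniq uniq_traject_porbit andbT -porbit_traject.
  by rewrite porbit_sym porbit_fixed // inE eq_sym.
have : nth i (traject s1 i #|porbit s i|.+1) #|porbit s i| = l.
  by rewrite traject_insert nth_rcons size_traject ltnn eqxx.
by rewrite nth_traject // => itl; rewrite iterS itl permM sl tpermR.
Qed.

Lemma porbit_insert : porbit s1 i = l |: porbit s i.
Proof.
apply/setP => x; rewrite porbit_traject card_porbit_insert traject_insert.
by rewrite mem_rcons !inE -porbit_traject.
Qed.

Lemma insert_out : {in ~: porbit s1 i, s1 =1 s}.
Proof.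
move=> x; rewrite porbit_insert !inE negb_or => /andP[xl xi]; rewrite permM tpermD //.
  by apply: contraNneq xi => ix; rewrite -(porbit_stable s) -ix porbit_id.
by apply: contra_neq xl => lx; apply: (@perm_inj _ s); rewrite sl.
Qed.
End RemovePoint.
End Porbits.

(** * Column and row determinants compared with minors and cofactors *)

Section PermSums.
Variables (R : realType) (n : nat) (M : 'M[quat R]_n).
Implicit Types (s : 'S_n) (i l x : 'I_n) (B : {set 'I_n}).

Definition is_orbit_min s x := [forall y in porbit s x, (x <= y)%N].

Definition orbit_mins B s := [seq x <- enum 'I_n | (x \in B) && is_orbit_min s x].

Definition orbits_prod B s := \prod_(x <- rev (orbit_mins B s)) cycle_prod M s x.

Definition open_prod s i : quat R :=
  \prod_(x <- traject s i #|porbit s i|.-1) M x (s x).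

(** The condition [s l == i] makes [l] the last vertex of the cycle opened by [i]; the closing
    factor [M l i] is left out, so that an entry of another column can take its place. *)
Definition perm_cofac B i l : quat R :=
  \sum_(s : 'S_n | perm_on B s && (s l == i))
    (-1) ^+ s * (orbits_prod (B :\: porbit s i) s * open_prod s i).

Definition perm_pdet B : quat R :=
  \sum_(s : 'S_n | perm_on B s) (-1) ^+ s * orbits_prod B s.

Lemma mem_orbit_mins B s x : (x \in orbit_mins B s) = (x \in B) && is_orbit_min s x.
Proof. by rewrite mem_filter mem_enum andbT. Qed.

Lemma cycle_prod_open s i : cycle_prod M s i = open_prod s i * M ((s^-1)%g i) i.
Proof.
rewrite /cycle_prod traject_rcons_inv -cats1 big_cat big_seq1 permKV.
by [].
Qed.

Lemma orbits_prod_eq B s s' :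
  {in B, forall x, porbit s x = porbit s' x /\ cycle_prod M s x = cycle_prod M s' x} ->
  orbits_prod B s = orbits_prod B s'.
Proof.
move=> E; rewrite /orbits_prod.
have -> : orbit_mins B s = orbit_mins B s'.
  apply: eq_filter => x /=; have [xB|//] := boolP (x \in B).
  by rewrite /is_orbit_min; case: (E x xB) => ->.
apply: eq_big_seq => x; rewrite mem_rev mem_orbit_mins => /andP[xB _].
by case: (E x xB).
Qed.

Lemma sum_perm_preim (P : pred 'S_n) i (F : 'S_n -> quat R) (G : 'I_n -> quat R) :
  \sum_l (\sum_(s : 'S_n | P s && (s l == i)) F s) * G l =
  \sum_(s | P s) F s * G ((s^-1)%g i).
Proof.
under eq_bigr => l _ do rewrite big_distrl /=.
rewrite (exchange_big_dep P) /=; last by move=> l s _ /andP[].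
apply: eq_bigr => s Ps; rewrite (big_pred1 ((s^-1)%g i)) // => l /=.
by rewrite Ps /=; apply/eqP/eqP => [<-|->]; rewrite ?permK ?permKV.
Qed.

(** The ordering convention of [cdet] enters here: the cycle of the least element heads the list,
    hence is the last factor of the reversed product. *)
Lemma orbit_mins_head B s i : perm_on B s -> i \in B ->
  {in B, forall x, (i <= x)%N} ->
  orbit_mins B s = i :: orbit_mins (B :\: porbit s i) s.
Proof.
move=> sB iB imin.
have E x : is_orbit_min s x -> x \in porbit s i -> x \in B -> x = i.
  move=> /forall_inP xmin xi xB; apply/val_inj/eqP; rewrite eqn_leq /= imin //.
  by rewrite xmin // porbit_sym.
have iM : is_orbit_min s i.
  apply/forall_inP => y yi; apply: imin; apply: contraT => yB.
  move: yi; rewrite porbit_sym (porbit_fixed (out_perm sB yB)) inE => /eqP iy.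
  by rewrite -iy iB in yB.
have srt (P : pred 'I_n) : sorted ltn (map val [seq x <- enum 'I_n | P x]).
  rewrite sorted_map; apply: sorted_filter => [x y z|]; first exact: ltn_trans.
  by rewrite -sorted_map val_enum_ord iota_ltn_sorted.
(* Both lists are strictly increasing, so it suffices that they have the same elements. *)
apply: (inj_map val_inj); apply: (irr_sorted_eq ltn_trans ltnn); first exact: srt.
  rewrite /= path_min_sorted; first exact: srt.
  apply/allP => _ /mapP[x xM ->].
  move: xM; rewrite mem_orbit_mins !inE => /andP[/andP[xi xB] _].
  rewrite /= ltn_neqAle imin // andbT; apply: contraNneq xi => /val_inj <-.
  exact: porbit_id.
apply: eq_mem_map => x; rewrite inE !mem_orbit_mins !inE.
have [->|xi] /= := eqVneq x i; first by rewrite iB iM.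
have [xp|//] := boolP (x \in porbit s i).
by apply/negbTE/andP => -[xB xM]; move/eqP: xi; apply; apply: E.
Qed.

Lemma perm_pdet0 : perm_pdet set0 = 1.
Proof.
rewrite /perm_pdet (big_pred1 (1%g : {perm _})) => [|s /=]; last first.
  apply/idP/eqP => [s0|->]; last exact: perm_on1.
  by apply/permP => x; rewrite perm1 (out_perm s0) ?inE.
rewrite odd_perm1 mul1r /orbits_prod /orbit_mins (@eq_filter _ _ pred0).
  by rewrite filter_pred0 big_nil.
by move=> x; rewrite inE.
Qed.

Lemma perm_pdet_cofac B i : i \in B -> {in B, forall x, (i <= x)%N} ->
  perm_pdet B = \sum_l perm_cofac B i l * M l i.
Proof.
move=> iB imin; rewrite sum_perm_preim; apply: eq_bigr => s sB.
rewrite -!mulrA -cycle_prod_open /orbits_prod (orbit_mins_head sB iB imin).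
by rewrite rev_cons -cats1 big_cat big_seq1.
Qed.

Lemma perm_cofac_out B i l : i \in B -> l \notin B -> perm_cofac B i l = 0.
Proof.
move=> iB lB; rewrite /perm_cofac big1 // => s /andP[sB].
by rewrite (out_perm sB lB) => /eqP li; rewrite li iB in lB.
Qed.

Lemma perm_onD1 B i s : perm_on (B :\ i) s = perm_on B s && (s i == i).
Proof.
apply/subsetP/andP => [sB|[/subsetP sB /eqP si] x].
  split; first by apply/subsetP => x /sB; rewrite !inE => /andP[].
  by apply/contraT => si; have := sB i; rewrite !inE eqxx => /(_ si).
rewrite !inE => sx; rewrite (sB x sx) andbT.
by apply: contraNneq sx => ->; rewrite si.
Qed.

Lemma perm_cofac_diag B i : i \in B -> perm_cofac B i i = perm_pdet (B :\ i).
Proof.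
move=> iB; apply: eq_big => [s|s /andP[sB /eqP si]]; first by rewrite perm_onD1.
by rewrite /open_prod porbit_fixed // cards1 big_nil mulr1.
Qed.

Lemma open_prod_insert s i l : s l = l -> l != i ->
  open_prod (s * tperm i l)%g i = open_prod s i * M ((s^-1)%g i) l.
Proof.
move=> sl li; rewrite /open_prod card_porbit_insert //=.
set s1 := (s * _)%g.
have -> : traject s1 i #|porbit s i| = traject s i #|porbit s i|.
  have := traject_insert sl li; rewrite trajectSr => /eqP.
  by rewrite eqseq_rcons => /andP[/eqP].
have U := uniq_traject_porbit s i.
rewrite traject_rcons_inv rcons_uniq in U; case/andP: U => iU _.
rewrite traject_rcons_inv -cats1 big_cat big_seq1 /= [s1 _]permM permKV tpermL.
congr (_ * _); apply: eq_big_seq => x xt; rewrite permM tpermD //.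
  by apply: contraNneq iU => ix; rewrite {1}ix permK.
apply: contra_neq li => lx; have xl : x = l by apply: (@perm_inj _ s); rewrite sl.
have : x \in porbit s i by rewrite porbit_traject traject_rcons_inv mem_rcons inE xt orbT.
by rewrite xl porbit_sym porbit_fixed // inE => /eqP.
Qed.

(** Multiplication by [tperm i l] is a bijection from the permutations of [B :\ l] to those of [B]
    that send [l] to [i]. It appends [l] to the cycle of [i], flips the sign and keeps the other
    cycles. *)
Lemma perm_cofac_rec B i l : i \in B -> l \in B -> l != i ->
  perm_cofac B i l = - \sum_t perm_cofac (B :\ l) i t * M t l.
Proof.
move=> iB lB li; rewrite sum_perm_preim -sumrN /perm_cofac.
rewrite (reindex_inj (mulIg (tperm i l))) /=.
have on_mul s : perm_on B (s * tperm i l)%g = perm_on B s.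
  have onT : perm_on B (tperm i l).
    by apply/subsetP => x; rewrite inE; case: tpermP => [->|->|]; rewrite ?eqxx.
  apply/idP/idP => sB; last exact: perm_onM.
  by rewrite -[s](mulgK (tperm i l)) tpermV; apply: perm_onM.
apply: eq_big => s; rewrite on_mul.
  rewrite perm_onD1 permM; congr (_ && _).
  by apply/eqP/eqP => [E|->]; rewrite ?tpermR //; apply: (@perm_inj _ (tperm i l)); rewrite tpermR.
rewrite permM => /andP[sB /eqP E].
have sl : s l = l by apply: (@perm_inj _ (tperm i l)); rewrite tpermR.
rewrite odd_permM odd_tperm eq_sym li addbT signrN mulNr open_prod_insert // !mulrA.
congr (- (_ * _ * _ * _)).
have -> : B :\: porbit (s * tperm i l) i = (B :\ l) :\: porbit s i.
  by rewrite porbit_insert // setDDl.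
apply: orbits_prod_eq => x; rewrite setDDl -porbit_insert // => xB.
pose A := ~: porbit (s * tperm i l)%g i.
have xA : x \in A by move: xB; rewrite !inE => /andP[].
have es : {in A, (s * tperm i l)%g =1 s} := insert_out sl li.
have stA : {in A, forall y, (s * tperm i l)%g y \in A}.
  by move=> y; rewrite !inE porbit_stable.
have eqp := eq_in_porbit es stA xA; split=> //.
have eqi := eq_in_iter es stA xA.
rewrite /cycle_prod eqp.
have -> : traject (s * tperm i l)%g x #|porbit s x| = traject s x #|porbit s x|.
  apply: (@eq_from_nth _ x); rewrite !size_traject // => k ltk.
  by rewrite !nth_traject // eqi.
apply: eq_big_seq => _ /trajectP[k _ ->]; congr (M _ _).
by rewrite es // -(eqi k) (eqi k).
Qed.

Hypothesis M_herm : forall x y, conj_quat (M x y) = M y x.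

(** Joint induction on [#|B|]: the cofactors on both sides obey the same recursions, which lead to
    smaller sets, and the minors are then expanded with the cofactors of [B] itself. *)
Lemma perm_pdet_cofacE B : perm_pdet B = pdet M B /\
  {in B, forall i l, perm_cofac B i l = cofac M B i l}.
Proof.
have [k] := ubnP #|B|; elim: k B => // k IH B ltk.
have EC : {in B, forall i l, perm_cofac B i l = cofac M B i l}.
  move=> i iB l; have [lB|lB] := boolP (l \in B); last first.
    by rewrite perm_cofac_out // cofac_outr.
  have [_ IHc] := IH (B :\ l) (ltn_cardsD1 lB ltk).
  have [->|li] := eqVneq l i.
    rewrite perm_cofac_diag // cofac_diag //.
    by case: (IH (B :\ i) (ltn_cardsD1 iB ltk)).
  rewrite perm_cofac_rec // cofac_rec //; congr (- _).
  by apply: eq_bigr => t _; rewrite IHc // !inE eq_sym li.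
split=> //; have [->|/set0Pn[i0 i0B]] := eqVneq B set0.
  by rewrite perm_pdet0 pdet0.
(* The ordered products are expanded at the least element of [B]; [pdet] allows any element. *)
case: (arg_minnP (fun x : 'I_n => val x) i0B) => i iB imin.
rewrite (perm_pdet_cofac iB imin) -(pdet_cofac M_herm iB).
by apply: eq_bigr => l _; rewrite EC.
Qed.

Lemma cycle_signE s : cycle_sign R s = (-1) ^+ s.
Proof.
rewrite /cycle_sign /odd_perm -signr_odd oddB ?card_ord //.
(* There are at most [n] cycles, so the natural subtraction in [cycle_sign] is not truncated. *)
by rewrite -[X in (_ <= X)%N](card_ord n) /porbits leq_imset_card.
Qed.

Lemma cycle_mins_orbits s i : cycle_mins s i = orbit_mins (setT :\: porbit s i) s.
Proof. by apply: eq_filter => x; rewrite !inE andbT. Qed.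

(** An entry of column [i] occurs in each product only as the very last factor. All other factors
    are those of the Hermitian [M], although the matrix with the replaced column need not be
    Hermitian. *)
Lemma cdet_replace_col i (c : 'cV[quat R]_n) :
  cdet (replace_col M i c) i = \sum_l cofac M setT i l * c l 0.
Proof.
have [_ /(_ i)] := perm_pdet_cofacE setT; rewrite inE => /(_ isT) EC.
under eq_bigr => l _ do rewrite -EC.
rewrite sum_perm_preim; apply: eq_big => [s|s _].
  by rewrite /perm_on; apply/esym/subsetP => x _; rewrite inE.
rewrite cycle_signE -!mulrA; congr (_ * _); rewrite cycle_mins_orbits.
congr (_ * _).
  apply: eq_big_seq => x; rewrite mem_rev mem_orbit_mins !inE andbT => /andP[xi _].
  apply: eq_big_seq => _ /trajectP[k _ ->]; rewrite mxE ifN //.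
  apply: contraNneq xi => <-; rewrite porbit_sym.
  by rewrite -iterS -permX mem_porbit.
rewrite /cycle_prod traject_rcons_inv -cats1 big_cat big_seq1 /= mxE permKV eqxx.
congr (_ * _); apply: eq_big_seq => x xt; rewrite mxE ifN //.
have := uniq_traject_porbit s i; rewrite traject_rcons_inv rcons_uniq => /andP[iU _].
by apply: contraNneq iU => ix; rewrite -{1}ix permK.
Qed.

Lemma cdet_herm i : cdet M i = pdet M setT.
Proof.
have {1}-> : M = replace_col M i (col i M).
  by apply/matrixP => k l; rewrite !mxE; case: eqP => [->|].
rewrite cdet_replace_col -(pdet_cofac M_herm (in_setT i)).
by apply: eq_bigr => l _; rewrite mxE.
Qed.

Lemma conj_cycle_prod s x : conj_quat (cycle_prod M s x) = cycle_prod M s^-1 x.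
Proof.
rewrite /cycle_prod conj_quat_prod porbitV.
(* The reversed listing starts at the predecessor of [x]; applying [s] once makes it start at
   [x]. *)
have -> : traject (s^-1)%g x #|porbit s x| = map s (rev (traject s x #|porbit s x|)).
  apply: (@eq_from_nth _ x); rewrite ?size_map ?size_rev !size_traject // => k ltk.
  rewrite nth_traject // (nth_map x) ?size_rev ?size_traject //.
  rewrite nth_rev ?size_traject // nth_traject ?subnSK ?leq_subr //.
  rewrite -iterS subnSK //; apply: (@perm_inj _ (s ^+ k)%g).
  rewrite !permX -iterD subnKC ?(ltnW ltk) // iter_porbit.
  by elim: k {ltk} => // k IH; rewrite iterSr iterS permKV.
by rewrite big_map; apply: eq_bigr => y _; rewrite M_herm permK.
Qed.

(** Conjugation turns [cdet M i] into [rdet M i] term by term, with [s] replaced by its inverse, and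
    the common value is real. *)
Lemma rdet_herm i : rdet M i = pdet M setT.
Proof.
rewrite -(conj_pdet M_herm) -(cdet_herm i) -[LHS]conj_quatK; congr conj_quat.
rewrite conj_quat_sum (reindex_inj (@invg_inj {perm 'I_n})); apply: eq_bigr => s _ /=.
rewrite !cycle_signE odd_permV conj_quatM.
have -> : conj_quat ((-1) ^+ s : quat R) = (-1) ^+ s.
  by case: (s : bool); rewrite ?expr1 ?expr0 ?conj_quatN conj_quat1.
rewrite [LHS]commr_sign; congr (_ * _).
rewrite conj_quatM conj_cycle_prod invgK conj_quat_prod; congr (_ * _).
have -> : cycle_mins s^-1 i = cycle_mins s i.
  by apply: eq_filter => x; rewrite !porbitV.
by apply: eq_bigr => x _; rewrite conj_cycle_prod invgK.
Qed.
End PermSums.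

(** * Increasing tuples and subsets of indices *)

Section IncreasingTuples.
Variables (r n : nat).
Implicit Types b : r.-tuple 'I_n.

Lemma Jset_uniq b : b \in Jset r n -> uniq b.
Proof.
rewrite inE => /(sorted_uniq ltn_trans ltnn); rewrite map_inj_uniq //.
exact: val_inj.
Qed.

Lemma Jset_tnth_inj b : b \in Jset r n -> injective (tnth b).
Proof. by move/Jset_uniq/tuple_uniqP. Qed.

Lemma imset_tnth b : tnth b @: setT = [set x in b].
Proof.
apply/setP => x; rewrite inE; apply/imsetP/tnthP => [[k _ ->]|[k ->]]; by exists k.
Qed.

(** An increasing tuple is determined by its set of entries, and [enum] lists any set in increasing
    order. *)
Lemma sum_Jset (V : nmodType) (P : pred {set 'I_n}) (F : {set 'I_n} -> V) :
  \sum_(b in Jset r n | P [set x in b]) F [set x in b] =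
  \sum_(B : {set 'I_n} | (#|B| == r) && P B) F B.
Proof.
pose h b := [set x in b].
pose J := [set b in Jset r n | P (h b)].
transitivity (\sum_(b in J) F (h b)).
  by apply: eq_bigl => b; rewrite [in RHS]inE.
rewrite -(big_imset F); last first.
  move=> b b'; rewrite !inE => /andP[sb _] /andP[sb' _] /setP hE; apply: val_inj.
  apply: (inj_map val_inj); apply: (irr_sorted_eq ltn_trans ltnn) => //.
  by apply: eq_mem_map => x; have := hE x; rewrite !inE.
apply: eq_bigl => B; apply/imsetP/andP => [[b]|[/eqP Br PB]].
  rewrite inE => /andP[bJ Pb] ->; split=> //.
  by rewrite cardsE (card_uniqP (Jset_uniq bJ)) size_tuple.
have szB : size (enum B) == r by rewrite -cardE Br.
have hB : h (Tuple szB) = B by apply/setP => x; rewrite inE mem_enum.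
exists (Tuple szB) => //; rewrite inE hB PB andbT inE /= {1}/enum_mem.
rewrite sorted_map; apply: sorted_filter => [x y z|]; first exact: ltn_trans.
by rewrite -enumT -sorted_map val_enum_ord iota_ltn_sorted.
Qed.

End IncreasingTuples.

(** * Coefficients of the determinant and of the adjugate of [t + M] *)

Section AdjointCoefficients.
Variables (R : realType) (n : nat) (M : 'M[quat R]_n).
Hypothesis M_herm : forall x y, conj_quat (M x y) = M y x.
Implicit Types (i l : 'I_n) (B : {set 'I_n}).

(* [\det (t + M)] is the sum of the [t ^ (n - k) * sum_pdet k], and the adjugate of
   [t + M] is the sum of the [t ^ (n - k) * sum_cofac k]. *)
Definition sum_pdet k : quat R := \sum_(B : {set 'I_n} | #|B| == k) pdet M B.

Definition sum_cofac k : 'M[quat R]_n :=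
  \matrix_(i, l) \sum_(B : {set 'I_n} | #|B| == k) cofac M B i l.

Lemma sum_card_insert (V : nmodType) k l (F : {set 'I_n} -> V) :
  \sum_(B : {set 'I_n} | (#|B| == k.+1) && (l \in B)) F B =
  \sum_(B : {set 'I_n} | (#|B| == k) && (l \notin B)) F (l |: B).
Proof.
rewrite (reindex_onto (fun B => l |: B) (fun B => B :\ l)) /=; last first.
  by move=> B /andP[_ lB]; rewrite setD1K.
apply: eq_bigl => B; rewrite setU11 andbT cardsU1.
have [lB|lB] /= := boolP (l \in B); last by rewrite setU1K // eqxx !andbT.
rewrite andbF; apply/negbTE; rewrite negb_and; apply/orP; right.
by apply/eqP => E; move: lB; rewrite -E !inE eqxx.
Qed.

Lemma sum_cofac_mul k i l :
  (sum_cofac k *m M) i l =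
  \sum_(B : {set 'I_n} | #|B| == k) \sum_t cofac M B i t * M t l.
Proof.
rewrite mxE exchange_big; apply: eq_bigr => t _ /=.
by rewrite mxE big_distrl.
Qed.

Lemma sum_cofac_mul_diag k i :
  (sum_cofac k *m M) i i = \sum_(B : {set 'I_n} | (#|B| == k) && (i \in B)) pdet M B.
Proof.
rewrite sum_cofac_mul (bigID (fun B : {set 'I_n} => i \in B)) /=.
rewrite [X in _ + X]big1 ?addr0 => [|B /andP[_ iB]]; last first.
  by rewrite big1 // => t _; rewrite cofac_outl ?mul0r.
by apply: eq_bigr => B /andP[_ iB]; rewrite pdet_cofac.
Qed.

(** Compares the coefficients of [t ^ (n - k)] in [adj (t + M) * (t + M) = det (t + M)]. *)
Lemma sum_cofac_rec k : sum_cofac k *m M + sum_cofac k.+1 = (sum_pdet k)%:M.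
Proof.
apply/matrixP => i l; rewrite [LHS]mxE [RHS]mxE [sum_cofac k.+1 i l]mxE.
rewrite [X in _ + X](bigID (fun B : {set 'I_n} => l \in B)) /=.
rewrite [X in _ + (_ + X)]big1 ?addr0 => [|B /andP[_ lB]]; last by rewrite cofac_outr.
rewrite sum_card_insert.
have [<-|il] := eqVneq i l.
  rewrite sum_cofac_mul_diag /sum_pdet mulr1n [RHS](bigID (fun B : {set 'I_n} => i \in B)) /=.
  congr (_ + _); apply: eq_bigr => B /andP[_ iB].
  by rewrite cofac_diag ?setU11 // setU1K.
(* Off the diagonal, sets containing [l] vanish by orthogonality; for the others, [cofac_rec] makes
   the term of [B] cancel that of [l |: B]. *)
rewrite sum_cofac_mul mulr0n (bigID (fun B : {set 'I_n} => l \in B)) /=.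
rewrite big1 ?add0r => [|B /andP[_ lB]]; last by rewrite cofac_orth.
rewrite -big_split big1 //= => B /andP[_ lB].
by rewrite (@cofac_rec _ _ _ (l |: B)) ?setU11 ?setU1K 1?eq_sym // subrr.
Qed.

Lemma conj_sum_pdet k : conj_quat (sum_pdet k) = sum_pdet k.
Proof. by rewrite conj_quat_sum; apply: eq_bigr => B _; rewrite conj_pdet. Qed.

(** Each minor of size [k] is counted once for every index it contains. *)
Lemma trace_sum_cofac_mul k : \tr (sum_cofac k *m M) = sum_pdet k *+ k.
Proof.
rewrite /mxtrace; under eq_bigr => i _ do rewrite sum_cofac_mul_diag.
rewrite (exchange_big_dep (fun B : {set 'I_n} => #|B| == k)) /=; last by move=> i B _ /andP[].
rewrite /sum_pdet -sumrMnl; apply: eq_bigr => B Bk.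
by under eq_bigl do rewrite Bk /=; rewrite sumr_const (eqP Bk).
Qed.

Lemma sum_pdet0 : sum_pdet 0 = 1.
Proof.
by rewrite /sum_pdet (big_pred1 set0) ?pdet0 // => B; rewrite cards_eq0.
Qed.

Lemma sum_cofac0 : sum_cofac 0 = 0.
Proof.
apply/matrixP => i l; rewrite !mxE big1 // => B; rewrite cards_eq0 => /eqP ->.
by rewrite cofac_outl ?inE.
Qed.

Lemma sum_cofac_oversize k : (n < k)%N -> sum_cofac k = 0.
Proof.
move=> nk; apply/matrixP => i l; rewrite !mxE big_pred0 // => B.
by apply: ltn_eqF; rewrite (leq_ltn_trans (max_card _)) // card_ord.
Qed.

Lemma card_eq_setT (B : {set 'I_n}) : (#|B| == n) = (B == setT).
Proof.
rewrite eqEcard subsetT cardsT card_ord eqn_leq.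
by have := max_card (mem B); rewrite card_ord => ->.
Qed.

Lemma hdet_herm : hdet M = pdet M setT.
Proof.
case: n M M_herm => [|n'] N N_herm /=; last by rewrite rdet_herm.
by rewrite [setT](_ : _ = set0) ?pdet0 //; apply/setP => -[].
Qed.

Lemma hdet_sum_pdet : hdet M = sum_pdet n.
Proof.
by rewrite hdet_herm /sum_pdet (big_pred1 setT) // => B; rewrite card_eq_setT.
Qed.

Lemma cdet_sum_cofac i (c : 'cV[quat R]_n) :
  cdet (replace_col M i c) i = (sum_cofac n *m c) i 0.
Proof.
rewrite cdet_replace_col // mxE; apply: eq_bigr => l _; congr (_ * _).
by rewrite mxE (big_pred1 setT) // => B; rewrite card_eq_setT.
Qed.

End AdjointCoefficients.

(** * The numerator and the denominator as [sum_cofac] and [sum_pdet] *)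

Section PrincipalSubmatrices.
Variables (R : realType) (r n : nat) (M : 'M[quat R]_n).
Hypothesis M_herm : forall x y, conj_quat (M x y) = M y x.
Implicit Types (b : r.-tuple 'I_n).

Lemma principal_submx_herm b x y :
  conj_quat (principal_submx M b x y) = principal_submx M b y x.
Proof. by rewrite !mxE. Qed.

Lemma hdet_principal b : b \in Jset r n ->
  hdet (principal_submx M b) = pdet M [set x in b].
Proof.
move=> bJ; rewrite (hdet_herm (principal_submx_herm b)) -imset_tnth.
by apply: pdet_relabel => // [|u v]; [apply: Jset_tnth_inj | rewrite mxE].
Qed.

Lemma sum_hdet_principal : \sum_(b in Jset r n) hdet (principal_submx M b) = sum_pdet M r.
Proof.
rewrite (eq_bigr (fun b : r.-tuple _ => pdet M [set x in b])); last exact: hdet_principal.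
under eq_bigl => b do rewrite -[_ \in _]andbT.
by rewrite (@sum_Jset _ _ _ predT (pdet M)); apply: eq_bigl => B; rewrite andbT.
Qed.

Lemma cdet_sub_cofac b i (c : 'cV[quat R]_n) : b \in Jset r n -> i \in b ->
  cdet_sub (replace_col M i c) b i = \sum_t cofac M [set x in b] i t * c t 0.
Proof.
move=> bJ ib; have tn_inj := Jset_tnth_inj bJ; rewrite /cdet_sub.
case: pickP => [k /eqP ik|none]; last first.
  by have /tnthP[k ik] := ib; have := none k; rewrite ik eqxx.
have -> : principal_submx (replace_col M i c) b =
          replace_col (principal_submx M b) k (\col_u c (tnth b u) 0).
  by apply/matrixP => u v; rewrite !mxE -ik (inj_eq tn_inj).
rewrite cdet_replace_col; last exact: principal_submx_herm.
rewrite (@sum_imset _ _ _ tn_inj _ _ setT) => [|t tb]; last first.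
  by rewrite cofac_outr ?mul0r // -imset_tnth.
apply: eq_bigr => u _; rewrite mxE -ik -imset_tnth; congr (_ * _).
by apply: cofac_relabel => // x y; rewrite mxE.
Qed.

(** The restriction to index sets containing [i] agrees with [sum_cofac], since row [i] of the
    cofactors of any other set is zero. *)
Lemma sum_cdet_sub i (c : 'cV[quat R]_n) :
  \sum_(b in Jset r n | i \in b) cdet_sub (replace_col M i c) b i =
  (sum_cofac M r *m c) i 0.
Proof.
rewrite (eq_bigr (fun b : r.-tuple _ => \sum_t cofac M [set x in b] i t * c t 0)); last first.
  by move=> b /andP[bJ ib]; apply: cdet_sub_cofac.
have E b : (i \in b) = (i \in [set x in b]) by rewrite inE.
under eq_bigl => b do rewrite E.
rewrite (@sum_Jset _ _ _ (fun B => i \in B) (fun B => \sum_t cofac M B i t * c t 0)).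
rewrite exchange_big mxE; apply: eq_bigr => t _ /=; rewrite -big_distrl mxE /=.
congr (_ * _); rewrite [RHS](bigID (fun B : {set 'I_n} => i \in B)) /=.
by rewrite [X in _ = _ + X]big1 ?addr0 // => B /andP[_ iB]; rewrite cofac_outl.
Qed.

End PrincipalSubmatrices.

(** * The real inner product, the normal equation and minimality of the norm *)

Section FrobeniusProduct.
Variable R : realType.
Local Notation H := (quat R).

Lemma ctrmxK m n (A : 'M[H]_(m, n)) : ctrmx (ctrmx A) = A.
Proof. by apply/matrixP => i j; rewrite !mxE conj_quatK. Qed.

Lemma ctrmx_mul m n p (A : 'M[H]_(m, n)) (B : 'M_(n, p)) :
  ctrmx (A *m B) = ctrmx B *m ctrmx A.
Proof.
apply/matrixP => i j; rewrite !mxE conj_quat_sum; apply: eq_bigr => k _.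
by rewrite !mxE conj_quatM.
Qed.

Lemma ctrmx0 m n : ctrmx (0 : 'M[H]_(m, n)) = 0.
Proof. by apply/matrixP => i j; rewrite !mxE conj_quat0. Qed.

Lemma gram_herm m n (A : 'M[H]_(m, n)) : forall x y,
  conj_quat ((ctrmx A *m A) x y) = (ctrmx A *m A) y x.
Proof.
move=> x y; have <- : ctrmx (ctrmx A *m A) = ctrmx A *m A by rewrite ctrmx_mul ctrmxK.
by rewrite mxE conj_quatK ctrmx_mul ctrmxK.
Qed.

Lemma mulmx_real m n (A : 'M[H]_(m, n)) d : conj_quat d = d -> A *m d%:M = d%:M *m A.
Proof.
move=> d_real; apply/matrixP => i j; rewrite mul_scalar_mx !mxE (bigD1 j) //=.
rewrite big1 => [|k kj]; rewrite !mxE ?(negPf kj) ?mulr0n ?mulr0 //.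
by rewrite eqxx mulr1n addr0 (conj_quat_fix_comm _ d_real).
Qed.

(** Quaternion entries do not commute, so cyclicity of the trace is available for its real part. *)
Lemma qre_mxtraceC m n (A : 'M[H]_(m, n)) (B : 'M_(n, m)) :
  qre (\tr (A *m B)) = qre (\tr (B *m A)).
Proof.
rewrite !qre_sum; under eq_bigr => i _ do rewrite mxE qre_sum.
rewrite exchange_big; apply: eq_bigr => j _; rewrite mxE qre_sum.
by apply: eq_bigr => i _; rewrite qreM_comm.
Qed.

Definition fdot m n (E D : 'M[H]_(m, n)) : R := qre (\tr (ctrmx E *m D)).

Definition sqfrob m n (E : 'M[H]_(m, n)) : R := \sum_i \sum_j sqnorm_quat (E i j).

Lemma fdotE m n (E D : 'M[H]_(m, n)) :
  fdot E D = \sum_i \sum_j qre (conj_quat (E i j) * D i j).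
Proof.
rewrite /fdot qre_sum exchange_big; apply: eq_bigr => j _; rewrite mxE qre_sum.
by apply: eq_bigr => i _; rewrite mxE.
Qed.

Lemma fdot_adj m n p (E : 'M[H]_(m, p)) (A : 'M_(m, n)) D :
  fdot E (A *m D) = fdot (ctrmx A *m E) D.
Proof. by rewrite /fdot mulmxA ctrmx_mul ctrmxK. Qed.

Lemma fdotBl m n (E E' D : 'M[H]_(m, n)) : fdot (E - E') D = fdot E D - fdot E' D.
Proof.
rewrite !fdotE -sumrB; apply: eq_bigr => i _; rewrite -sumrB; apply: eq_bigr => j _.
by rewrite !mxE; case: (E i j) (E' i j) (D i j) => [????] [????] [????] /=; ring.
Qed.

Lemma fdot0r m n (E : 'M[H]_(m, n)) : fdot E 0 = 0.
Proof. by rewrite /fdot mulmx0 mxtrace0. Qed.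

Lemma fdot_sq m n (E : 'M[H]_(m, n)) : fdot E E = sqfrob E.
Proof.
rewrite fdotE; apply: eq_bigr => i _; apply: eq_bigr => j _.
by rewrite /sqnorm_quat; case: (E i j) => [????] /=; ring.
Qed.

Lemma sqnorm_ge0 (x : H) : 0 <= sqnorm_quat x.
Proof. by rewrite /sqnorm_quat !addr_ge0 // sqr_ge0. Qed.

Lemma sqfrob_ge0 m n (E : 'M[H]_(m, n)) : 0 <= sqfrob E.
Proof. by apply: sumr_ge0 => i _; apply: sumr_ge0 => j _; apply: sqnorm_ge0. Qed.

Lemma sqfrob_eq0 m n (E : 'M[H]_(m, n)) : sqfrob E = 0 -> E = 0.
Proof.
move/eqP; rewrite psumr_eq0 => [/allP E0|i _]; last first.
  by apply: sumr_ge0 => j _; apply: sqnorm_ge0.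
apply/matrixP => i j; rewrite mxE; apply/eqP; rewrite -sqnorm_quat_eq0.
have := E0 i (mem_index_enum _); rewrite psumr_eq0 => [/allP Ei|k _].
  exact: Ei j (mem_index_enum _).
exact: sqnorm_ge0.
Qed.

Lemma sqfrob_line m n (E D : 'M[H]_(m, n)) (t : R) :
  sqfrob (E + (Quat t 0 0 0)%:M *m D) = sqfrob E + 2 * t * fdot E D + t ^+ 2 * sqfrob D.
Proof.
rewrite mul_scalar_mx fdotE /sqfrob !mulr_sumr -!big_split; apply: eq_bigr => i _ /=.
rewrite !mulr_sumr -!big_split; apply: eq_bigr => j _; rewrite !mxE /sqnorm_quat.
by case: (E i j) (D i j) => [????] [????] /=; ring.
Qed.

Lemma frobenius_le m n (E D : 'M[H]_(m, n)) :
  (frobenius E <= frobenius D) = (sqfrob E <= sqfrob D).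
Proof. by rewrite /frobenius ler_sqrt // sqfrob_ge0. Qed.

Lemma fdot_eq0_of_line_min m n (E D : 'M[H]_(m, n)) :
  (forall t, frobenius E <= frobenius (E + (Quat t 0 0 0)%:M *m D)) -> fdot E D = 0.
Proof.
move=> Emin; set a := fdot E D; have b0 := sqfrob_ge0 D; set b := sqfrob D in b0.
have b1 : b + 1 != 0 by rewrite gt_eqF // ltr_wpDl.
(* The quadratic in [t] has its minimum at [- a / b]; the denominator [b + 1] also covers [D = 0]
   and still gives a strict decrease unless [a = 0]. *)
have := Emin (- a / (b + 1)); rewrite frobenius_le sqfrob_line -/a -/b -subr_ge0.
have -> : sqfrob E + 2 * (- a / (b + 1)) * a + (- a / (b + 1)) ^+ 2 * b - sqfrob E =
          - ((b + 2) * (a / (b + 1)) ^+ 2) by field.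
rewrite oppr_ge0 pmulr_rle0 ?ltr_wpDl // => a0.
have : a / (b + 1) == 0 by rewrite -sqrf_eq0 eq_le a0 sqr_ge0.
by rewrite mulf_eq0 invr_eq0 (negPf b1) orbF => /eqP.
Qed.

Lemma ctrmx_mul_eq0 m n (E : 'M[H]_(m, n)) : ctrmx E *m E = 0 -> E = 0.
Proof. by move=> E0; apply: sqfrob_eq0; rewrite -fdot_sq /fdot E0 mxtrace0. Qed.

Lemma least_squares_normal m n s (A : 'M[H]_(m, n)) (B : 'M_(m, s)) X :
  least_squares A B X -> ctrmx A *m A *m X = ctrmx A *m B.
Proof.
move=> Xmin; apply/eqP; rewrite -subr_eq0 -mulmxA -mulmxBr; apply/eqP/sqfrob_eq0.
rewrite -fdot_sq -fdot_adj; apply: fdot_eq0_of_line_min => t.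
(* [X] is moved along a multiple of the gradient of the squared residual; the real scalar [t] passes
   through [A]. *)
have := Xmin (X + (Quat t 0 0 0)%:M *m (ctrmx A *m (A *m X - B))).
rewrite (mulmxDr A X) [A *m (_%:M *m _)]mulmxA mulmx_real; last by congr Quat; rewrite /= oppr0.
by rewrite -mulmxA addrAC.
Qed.

(** Adding real multiples of [Z] keeps the residual, so [X] has least norm on this line. *)
Lemma min_norm_orth m n s (A : 'M[H]_(m, n)) (B : 'M_(m, s)) X Z :
  min_norm_least_squares A B X -> A *m Z = 0 -> fdot X Z = 0.
Proof.
move=> [Xls Xmin] AZ; apply: fdot_eq0_of_line_min => t; apply: Xmin => Y.
rewrite (mulmxDr A X) [A *m (_%:M *m _)]mulmxA mulmx_real; last by congr Quat; rewrite /= oppr0.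
by rewrite -mulmxA AZ mulmx0 addr0; apply: Xls.
Qed.

End FrobeniusProduct.

(** * Rank as a trace *)

Section Rank.
Variable R : realType.
Local Notation H := (quat R).

Lemma rcolspace_factor m n p (A : 'M[H]_(m, n)) (P : 'M[H]_(m, p)) :
  (forall v, in_rcolspace A v -> in_rcolspace P v) -> exists C, A = P *m C.
Proof.
move=> AP; have cols j : exists c, col j A = P *m c.
  by apply: AP; exists (delta_mx j 0); rewrite colE.
have [f fE] := fin_all_exists cols; exists (\matrix_(i, j) f j i 0).
apply/matrixP => i j; have /matrixP/(_ i 0) := fE j; rewrite !mxE => ->.
by apply: eq_bigr => k _; rewrite mxE.
Qed.

Lemma rcol_free_inj m p q (P : 'M[H]_(m, p)) (Y Z : 'M_(p, q)) :
  rcol_free P -> P *m Y = P *m Z -> Y = Z.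
Proof.
move=> Pfree PYZ; apply/eqP; rewrite -subr_eq0; apply/eqP/matrixP => i j.
have /matrixP/(_ i 0) : col j (Y - Z) = 0.
  by apply: Pfree; rewrite colE mulmxA mulmxBr PYZ subrr mul0mx.
by rewrite !mxE.
Qed.

(** Factor [A = P *m C] through a basis of [r] columns. Cyclicity replaces [Z *m A] by the [r] by
    [r] matrix [C *m Z *m P], which is the scalar matrix [d]. *)
Lemma has_rank_trace m n r (A : 'M[H]_(m, n)) (Z : 'M_(n, m)) d :
  has_rank A r -> conj_quat d = d -> A *m (Z *m A) = A *m d%:M ->
  qre (\tr (Z *m A)) = qre d *+ r.
Proof.
move=> [P [Pfree PA]] d_real AZA.
have [|C AE] := @rcolspace_factor _ _ _ A P; first by move=> v /PA.
have [|D PE] := @rcolspace_factor _ _ _ P A; first by move=> v /PA.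
have CD : C *m D = 1%:M.
  by apply: (rcol_free_inj Pfree); rewrite mulmx1 mulmxA -AE -PE.
have CZA : C *m (Z *m A) = C *m d%:M.
  by apply: (rcol_free_inj Pfree); rewrite [LHS]mulmxA [RHS]mulmxA -AE.
have CZP : C *m Z *m P = d%:M.
  rewrite PE mulmxA -(mulmxA C) CZA -mulmxA -(mulmx_real D) //.
  by rewrite mulmxA CD mul1mx.
rewrite AE mulmxA qre_mxtraceC mulmxA CZP mxtrace_scalar.
by rewrite qreMn.
Qed.

End Rank.

(** * The projection obtained from the cofactors and the minimum norm solution *)

Section MinNormSolution.
Variables (R : realType) (m n s : nat).
Local Notation H := (quat R).
Variables (A : 'M[H]_(m, n)) (B : 'M[H]_(m, s)) (X : 'M[H]_(n, s)).
Let M := ctrmx A *m A.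
Let M_herm : forall x y, conj_quat (M x y) = M y x := gram_herm A.
Local Notation P := (sum_cofac M).
Local Notation d := (sum_pdet M).

(** By the recursion, [P k] is a polynomial in [M] with real coefficients. *)
Lemma sum_cofac_comm k : P k *m M = M *m P k.
Proof.
elim: k => [|k IH]; first by rewrite sum_cofac0 mul0mx mulmx0.
have -> : P k.+1 = (d k)%:M - P k *m M by rewrite -(sum_cofac_rec M_herm) addrC addKr.
by rewrite mulmxBl mulmxBr (mulmx_real _ (conj_sum_pdet M_herm k)) (mulmxA M) -IH.
Qed.

Lemma mul_gram_eq0 p (Y : 'M[H]_(n, p)) : M *m Y = 0 -> A *m Y = 0.
Proof.
by move=> MY; apply: ctrmx_mul_eq0; rewrite ctrmx_mul -mulmxA (mulmxA _ A) -/M MY mulmx0.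
Qed.

Lemma mul_gram2_eq0 p (Y : 'M[H]_(p, n)) : Y *m M *m M = 0 -> Y *m M = 0.
Proof.
have Mt : ctrmx M = M by rewrite /M ctrmx_mul ctrmxK.
move=> YMM; rewrite -[LHS]ctrmxK; apply/(canLR (@ctrmxK _ _ _)); rewrite ctrmx0.
by apply: ctrmx_mul_eq0; rewrite ctrmxK ctrmx_mul Mt mulmxA YMM mul0mx.
Qed.

Lemma sum_cofac_mul_eq0 k : (forall j, (k < j)%N -> d j = 0) ->
  forall j, (k < j)%N -> P j *m M = 0.
Proof.
(* Descending induction on [j], starting beyond [n], where [P j = 0]. *)
move=> d0 j; have [e] := ubnP (n.+1 - j); elim: e j => // e IH j lte kj.
have [nj|jn] := ltnP n j; first by rewrite sum_cofac_oversize // mul0mx.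
(* As [d j = 0], the recursion gives [P j *m M = - P j.+1], and one more factor [M] makes the
   induction hypothesis apply. *)
have Pj := sum_cofac_rec M_herm j; apply: mul_gram2_eq0.
move/eqP: Pj; rewrite d0 // raddf0 addr_eq0 => /eqP ->.
rewrite mulNmx IH ?oppr0 // ?leqW //.
by rewrite -ltnS (leq_trans _ lte) // ltnS subnSK.
Qed.

Lemma last_sum_pdet : exists k, d k != 0 /\ forall j, (k < j)%N -> d j = 0.
Proof.
have dn j : (n < j)%N -> d j = 0.
  move=> nj; rewrite /sum_pdet big_pred0 // => C.
  by apply: ltn_eqF; rewrite (leq_ltn_trans (max_card _)) // card_ord.
have ex : exists k, d k != 0 by exists 0%N; rewrite sum_pdet0 oner_eq0.
have ub k : d k != 0 -> (k <= n)%N by apply: contraNleq => /dn ->.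
case: (ex_maxnP ex ub) => k dk kmax; exists k; split=> // j.
by rewrite ltnNge; apply: contraNeq => /kmax.
Qed.

(** It suffices to compare after multiplication by [ctrmx A]. There the difference is
    [- P k.+1 *m M], because [P k] commutes with [M]. *)
Lemma mul_sum_cofac_last k : (forall j, (k < j)%N -> d j = 0) ->
  A *m (P k *m M) = A *m (d k)%:M.
Proof.
move=> d0; apply/eqP; rewrite -subr_eq0 -mulmxBr; apply/eqP/mul_gram_eq0.
have Pk := sum_cofac_mul_eq0 d0 (ltnSn k).
rewrite mulmxBr (mulmx_real _ (conj_sum_pdet M_herm k)) -(sum_cofac_rec M_herm).
by rewrite mulmxDl Pk addr0 mulmxA -sum_cofac_comm subrr.
Qed.

Lemma has_rank_sum_pdet r : has_rank A r ->
  d r != 0 /\ A *m (P r *m M) = A *m (d r)%:M.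
Proof.
move=> rA; have [k [dk d0]] := last_sum_pdet.
have AP := mul_sum_cofac_last d0.
suff -> : r = k by [].
have dR := conj_sum_pdet M_herm k.
(* The trace of [P k *m M] has real part [k] times that of [d k] by counting, and [r] times it by
   the rank. *)
have := has_rank_trace rA dR (Z := P k *m ctrmx A).
rewrite -mulmxA => /(_ AP); rewrite trace_sum_cofac_mul // qreMn.
move=> kr; have dk0 : qre (d k) != 0.
  apply: contra_neq dk => dk0.
  by apply: conj_quat_fix_inj; rewrite ?conj_quat0.
apply/eqP; rewrite -(eqr_nat R); apply/eqP/(mulfI dk0).
by rewrite !mulr_natr -kr.
Qed.

Hypothesis X_min : min_norm_least_squares A B X.

(** The columns of [Z = d X - P M X] lie in the kernel of [A]. Both terms are orthogonal to [Z]: the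
    first by minimality of the norm, the second because [P M X = M P X] has its columns in the range
    of [ctrmx A]. Hence [Z = 0]. *)
Lemma min_norm_sum_cofac r i j : has_rank A r ->
  X i j = (P r *m col j (ctrmx A *m B)) i 0 / d r.
Proof.
move=> /has_rank_sum_pdet[dr AP]; have dR := conj_sum_pdet M_herm r.
have PB : P r *m (ctrmx A *m B) = P r *m M *m X.
  by rewrite -mulmxA -(least_squares_normal (proj1 X_min)).
pose Z := (d r)%:M *m X - P r *m M *m X.
have AZ : A *m Z = 0 by rewrite mulmxBr !(mulmxA A _ X) AP subrr.
have Z0 : Z = 0.
  apply: sqfrob_eq0; rewrite -fdot_sq {1}/Z fdotBl.
  have dt : (d r)%:M = ctrmx (d r)%:M :> 'M_n.
    by apply/matrixP => k l; rewrite !mxE eq_sym; case: eqP; rewrite ?mulr1n ?mulr0n ?conj_quat0 ?dR.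
  rewrite {1}dt -fdot_adj (min_norm_orth X_min); last first.
    by rewrite mulmxA mulmx_real // -mulmxA AZ mulmx0.
  by rewrite sum_cofac_comm -!mulmxA -fdot_adj AZ fdot0r subrr.
have /matrixP/(_ i j) : (d r)%:M *m X = P r *m (ctrmx A *m B).
  by apply/eqP; rewrite PB -subr_eq0 -/Z Z0.
rewrite mul_scalar_mx !mxE => dX.
under eq_bigr => k _ do rewrite [col _ _ _ _]mxE.
(* The factor [d r] stands on the left but is divided out on the right, which is harmless as it is
   real. *)
by rewrite -dX (conj_quat_fix_comm _ dR) mulrK.
Qed.

End MinNormSolution.

Theorem theorem4p2 (R : realType) (m n s : nat)
    (A : 'M[quat R]_(m, n)) (B : 'M[quat R]_(m, s)) (X : 'M[quat R]_(n, s))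
    (hX : min_norm_least_squares A B X) :
  (forall r : nat, has_rank A r -> (1 <= r)%N -> (r <= m)%N -> (m < n)%N ->
     forall (i : 'I_n) (j : 'I_s),
       X i j =
         (\sum_(b in Jset r n | i \in b)
            cdet_sub
              (replace_col (ctrmx A *m A) i (col j (ctrmx A *m B))) b i) /
         (\sum_(b in Jset r n) hdet (principal_submx (ctrmx A *m A) b)))
  /\
  (has_rank A n ->
     forall (i : 'I_n) (j : 'I_s),
       X i j = cdet (replace_col (ctrmx A *m A) i (col j (ctrmx A *m B))) i /
               hdet (ctrmx A *m A)).
Proof.
have M_herm := gram_herm A; split=> [r rA _ _ _ i j|nA i j].
  by rewrite sum_cdet_sub // sum_hdet_principal // -(min_norm_sum_cofac hX).
by rewrite cdet_sum_cofac // hdet_sum_pdet // -(min_norm_sum_cofac hX).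
Qed.
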